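(* Let $\theta,\eta\in K_0(\mathcal{A})_{\mathbb{R}}^*$. (a) Assume $M=M_1\oplus M_2\in\mathcal{A}$. Then $\theta$ and $\eta$ are $M$-TF equivalent if and only if they are $M_1$-TF equivalent and $M_2$-TF equivalent. (b) The elements $\theta$ and $\eta$ are TF equivalent if and only if $\theta$ and $\eta$ are $M$-TF equivalent for every $M\in\mathcal{A}$, if and only if $\theta$ and $\eta$ are $M$-TF equivalent for every brick $M$ in $\mathcal{A}$.
   Context: $\mathcal{A}$ is an abelian length category (every object has finite length) with only finitely many isoclasses $S(1),\ldots,S(n)$ of simple objects. $K_0(\mathcal{A})_{\mathbb{R}}=K_0(\mathcal{A})\otimes_{\mathbb{Z}}\mathbb{R}=\bigoplus_{i=1}^n\mathbb{R}[S(i)]$, and $K_0(\mathcal{A})_{\mathbb{R}}^*=\operatorname{Hom}_{\mathbb{R}}(K_0(\mathcal{A})_{\mathbb{R}},\mathbb{R})$. For $\theta\in K_0(\mathcal{A})_{\mathbb{R}}^*$ and $X\in\mathcal{A}$, write $\theta(X):=\theta([X])$. A brick in $\mathcal{A}$ is a nonzero object all of whose nonzero endomorphisms are isomorphisms. Semistable torsion pairs. For $\theta\in K_0(\mathcal{A})_{\mathbb{R}}^*$ define full subcategories of $\mathcal{A}$: $\overline{\mathcal{T}}_\theta$ = objects $X$ with $\theta(N)\ge0$ for every factor object $N$ of $X$; $\mathcal{F}_\theta$ = objects $X$ with $\theta(L)<0$ for every nonzero subobject $L$ of $X$; $\mathcal{T}_\theta$ = objects $X$ with $\theta(N)>0$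 for every nonzero factor object $N$ of $X$; $\overline{\mathcal{F}}_\theta$ = objects $X$ with $\theta(L)\le0$ for every subobject $L$ of $X$. Then $(\overline{\mathcal{T}}_\theta,\mathcal{F}_\theta)$ and $(\mathcal{T}_\theta,\overline{\mathcal{F}}_\theta)$ are torsion pairs, and $\mathcal{W}_\theta:=\overline{\mathcal{T}}_\theta\cap\overline{\mathcal{F}}_\theta$ is a wide subcategory of $\mathcal{A}$, which is an abelian category of finite length. For $M\in\mathcal{A}$, $\overline{\mathrm{t}}_\theta M$ (resp. $\mathrm{t}_\theta M$) is the largest subobject of $M$ lying in $\overline{\mathcal{T}}_\theta$ (resp. $\mathcal{T}_\theta$), $\mathrm{f}_\theta M:=M/\overline{\mathrm{t}}_\theta M$, $\overline{\mathrm{f}}_\theta M:=M/\mathrm{t}_\theta M$, $\mathrm{w}_\theta M:=\overline{\mathrm{t}}_\theta M/\mathrm{t}_\theta M\in\mathcal{W}_\theta$. For $X\in\mathcal{W}_\theta$, $\mathsf{supp}_\theta X$ is the set of isoclasses of composition factors of $X$ in $\mathcal{W}_\theta$. TF equivalence: $\theta,\eta$ are TF equivalent if $(\overline{\mathcal{T}}_\theta,\mathcal{F}_\theta)=(\overline{\mathcal{T}}_\eta,\mathcal{F}_\eta)$ and $(\mathcal{T}_\theta,\overline{\mathcal{F}}_\theta)=(\mathcal{T}_\eta,\overline{\mathcal{F}}_\eta)$. $M$-TF equivalence: $\theta,\eta$ are $M$-TF equivalent if (i) $\mathrm{t}_\theta M=\mathrm{t}_\eta M$, $\mathrm{w}_\theta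 M=\mathrm{w}_\eta M$, $\mathrm{f}_\theta M=\mathrm{f}_\eta M$ (equivalently $\mathrm{t}_\theta M=\mathrm{t}_\eta M$ and $\overline{\mathrm{t}}_\theta M=\overline{\mathrm{t}}_\eta M$ as subobjects of $M$), and (ii) $\mathsf{supp}_\theta(\mathrm{w}_\theta M)=\mathsf{supp}_\eta(\mathrm{w}_\eta M)$. *)

(* Defs.v *)
From Stdlib Require List.
From HB Require Import structures.
From mathcomp Require Import all_boot all_order.
From mathcomp Require Import ssralg ssrnum ssrint generic_quotient ring_quotient.
From mathcomp Require Import boolp reals.
From mathcomp Require Import freeg.

Set Implicit Arguments.
Unset Strict Implicit.
Unset Printing Implicit Defensive.

Import GRing.Theory.
Local Open Scope ring_scope.
Local Open Scope quotient_scope.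

(* If no element satisfies [P], the value is [d]. *)
Definition pick_or (T : Type) (d : T) (P : T -> Prop) : T :=
  if pselect (exists x, P x) is left e then sval (cid e) else d.

Lemma pick_orP (T : Type) (d : T) (P : T -> Prop) :
  (exists x, P x) -> P (pick_or d P).
Proof. by rewrite /pick_or; case: pselect => // e _; exact: svalP (cid e). Qed.

Section Presented.
Variables (R : nzRingType) (T : Type).

Definition freemod : lmodType R := {freeg {classic T} / R}.
Definition freegen (x : T) : freemod := << (x : {classic T}) >>.

Variable rel : freemod -> Prop.

Definition relspan : {pred freemod} := fun x =>
  `[< forall P : freemod -> Prop,
        (forall r, rel r -> P r) -> P 0 ->
        (forall (a : R) u v, P u -> P v -> P (a *: u + v)) -> P x >].

Lemma relspanP x : reflect (forall P : freemod -> Prop,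
    (forall r, rel r -> P r) -> P 0 ->
    (forall (a : R) u v, P u -> P v -> P (a *: u + v)) -> P x)
  (x \in relspan).
Proof. exact: asboolP. Qed.

Lemma relspan_closed : submod_closed relspan.
Proof.
split=> [|a u v /relspanP uS /relspanP vS]; apply/relspanP => P Pr P0 PD //.
by apply: (PD); [exact: uS|exact: vS].
Qed.

HB.instance Definition _ := GRing.isSubmodClosed.Build R freemod relspan
  relspan_closed.

Definition presented : Type := Quotient.quot relspan.

HB.instance Definition _ := GRing.Zmodule.copy presented (Quotient.quot relspan).

Definition pres_pi (x : freemod) : presented := \pi_(Quotient.quot relspan) x.
Definition pres_repr (u : presented) : freemod :=
  repr (u : Quotient.quot relspan).

Definition pres_gen (x : T) : presented := pres_pi (freegen x).
Definition pres_scale (a : R) (u : presented) : presented :=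
  pres_pi (a *: pres_repr u).

Lemma pres_reprK : cancel pres_repr pres_pi.
Proof. by move=> u; exact: reprK. Qed.

Lemma pres_piP x y : pres_pi x = pres_pi y <-> x - y \in relspan.
Proof. by rewrite Quotient.idealrBE; split=> /eqP. Qed.

Lemma pres_piD : {morph pres_pi : x y / x + y}.
Proof. exact: Quotient.pi_add. Qed.

Lemma pres_piN : {morph pres_pi : x / - x}.
Proof. exact: Quotient.pi_opp. Qed.

Lemma pres_scale_pi a x : pres_scale a (pres_pi x) = pres_pi (a *: x).
Proof.
apply/pres_piP; rewrite -scalerBr rpredZ //.
by apply/pres_piP; rewrite pres_reprK.
Qed.

Lemma pres_scaleA a b u : pres_scale a (pres_scale b u) = pres_scale (a * b) u.
Proof. by rewrite -(pres_reprK u) !pres_scale_pi scalerA. Qed.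

Lemma pres_scale1 : left_id 1 pres_scale.
Proof. by move=> u; rewrite -(pres_reprK u) pres_scale_pi scale1r. Qed.

Lemma pres_scaleDr : right_distributive pres_scale +%R.
Proof.
move=> a u v; rewrite -(pres_reprK u) -(pres_reprK v).
by rewrite -pres_piD !pres_scale_pi scalerDr pres_piD.
Qed.

Lemma pres_scaleDl u : {morph pres_scale^~ u : a b / a + b}.
Proof.
by move=> a b; rewrite -(pres_reprK u) !pres_scale_pi scalerDl pres_piD.
Qed.

HB.instance Definition _ := GRing.Zmodule_isLmodule.Build R presented
  pres_scaleA pres_scale1 pres_scaleDr pres_scaleDl.

Lemma pres_pi_rel3 (x y z : T) :
  rel (freegen x - freegen y - freegen z) ->
  pres_gen x = pres_gen y + pres_gen z.
Proof.
move=> rxyz; rewrite -pres_piD; apply/pres_piP; rewrite opprD addrA.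
by apply/relspanP => P Pr _ _; exact: Pr.
Qed.

End Presented.

(* G (x)_Z R: the bilinearity relations of the tensor product are linearity in
   the R-variable, built into the free R-module on G, and additivity in the
   G-variable, which is imposed here. *)
Definition tensorZ_rel (R : nzRingType) (G : zmodType) (r : freemod R G) : Prop :=
  exists g h : G, r = freegen R (g + h) - freegen R g - freegen R h.

Definition tensorZ (R : nzRingType) (G : zmodType) : lmodType R :=
  presented (@tensorZ_rel R G).

(* g (x) 1 *)
Definition tensorZ1 (R : nzRingType) (G : zmodType) (g : G) : tensorZ R G :=
  pres_gen (@tensorZ_rel R G) g.

Record preaddCat := PreaddCat {
  obj :> Type;
  hom : obj -> obj -> zmodType;
  idm : forall X, hom X X;
  comp : forall X Y Z, hom Y Z -> hom X Y -> hom X Z;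
  compA : forall X Y Z U (h : hom Z U) (g : hom Y Z) (f : hom X Y),
    comp h (comp g f) = comp (comp h g) f;
  comp1m : forall X Y (f : hom X Y), comp (idm Y) f = f;
  compm1 : forall X Y (f : hom X Y), comp f (idm X) = f;
  compDl : forall X Y Z (g g' : hom Y Z) (f : hom X Y),
    comp (g + g') f = comp g f + comp g' f;
  compDr : forall X Y Z (g : hom Y Z) (f f' : hom X Y),
    comp g (f + f') = comp g f + comp g f' }.

Arguments idm {p} X.
Arguments comp {p X Y Z} g f.

Notation "g \oc f" := (comp g f) (at level 40, left associativity).

Section CategoryNotions.
Variable C : preaddCat.
Implicit Types X Y Z L M N S : C.

Definition mono X Y (f : hom X Y) : Prop :=
  forall Z (g h : hom Z X), f \oc g = f \oc h -> g = h.

Definition epi X Y (f : hom X Y) : Prop :=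
  forall Z (g h : hom Y Z), g \oc f = h \oc f -> g = h.

Definition iso X Y (f : hom X Y) : Prop :=
  exists g : hom Y X, g \oc f = idm X /\ f \oc g = idm Y.

Definition isomorphic X Y : Prop := exists f : hom X Y, iso f.

Definition is_zero X : Prop :=
  (forall Y (f : hom X Y), f = 0) /\ (forall Y (f : hom Y X), f = 0).

Definition is_kernel L X Y (k : hom L X) (f : hom X Y) : Prop :=
  f \oc k = 0 /\
  forall Z (g : hom Z X), f \oc g = 0 -> exists! h : hom Z L, k \oc h = g.

Definition is_cokernel X Y N (c : hom Y N) (f : hom X Y) : Prop :=
  c \oc f = 0 /\
  forall Z (g : hom Y Z), g \oc f = 0 -> exists! h : hom N Z, h \oc c = g.

Definition is_biproduct M1 M2 M (i1 : hom M1 M) (i2 : hom M2 M)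
    (p1 : hom M M1) (p2 : hom M M2) : Prop :=
  [/\ p1 \oc i1 = idm M1, p2 \oc i2 = idm M2, p1 \oc i2 = 0, p2 \oc i1 = 0
    & i1 \oc p1 + i2 \oc p2 = idm M].

Definition ses L X N (i : hom L X) (p : hom X N) : Prop :=
  is_kernel i p /\ is_cokernel p i.

Definition simple S : Prop :=
  ~ is_zero S /\
  forall L (i : hom L S), mono i -> is_zero L \/ iso i.

Definition brick X : Prop :=
  ~ is_zero X /\ forall f : hom X X, f <> 0 -> iso f.

(* [comp_series X s]: [X] has a composition series whose factors, from the top
   one to the bottom one, are the members of [s]. *)
Inductive comp_series : C -> seq C -> Prop :=
| comp_series_zero X : is_zero X -> comp_series X [::]
| comp_series_cons L X S (i : hom L X) (p : hom X S) s :
    ses i p -> simple S -> comp_series L s -> comp_series X (S :: s).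

Definition finite_length X : Prop := exists s, comp_series X s.

Definition composition_factor X S : Prop :=
  exists s, comp_series X s /\ exists S', List.In S' s /\ isomorphic S' S.

Definition lists_simples (n : nat) (S : 'I_n -> C) : Prop :=
  [/\ forall i, simple (S i),
      forall i j, isomorphic (S i) (S j) -> i = j
    & forall X, simple X -> exists i, isomorphic X (S i)].

End CategoryNotions.

Record abelian (C : preaddCat) : Prop := Abelian {
  ab_zero : exists Z : C, is_zero Z;
  ab_biproduct : forall M1 M2 : C,
    exists M (i1 : hom M1 M) (i2 : hom M2 M) (p1 : hom M M1) (p2 : hom M M2),
      is_biproduct i1 i2 p1 p2;
  ab_kernel : forall (X Y : C) (f : hom X Y),
    exists L (k : hom L X), is_kernel k f;
  ab_cokernel : forall (X Y : C) (f : hom X Y),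
    exists N (c : hom Y N), is_cokernel c f;
  ab_mono : forall (X Y : C) (f : hom X Y), mono f ->
    exists Z (g : hom Y Z), is_kernel f g;
  ab_epi : forall (X Y : C) (f : hom X Y), epi f ->
    exists Z (g : hom Z X), is_cokernel f g }.

Definition length_category (C : preaddCat) : Prop :=
  abelian C /\ forall X : C, finite_length X.

Definition full_subcat (C : preaddCat) (P : C -> Prop) : preaddCat :=
  @PreaddCat {X : C | P X}
    (fun X Y => hom (sval X) (sval Y))
    (fun X => idm (sval X))
    (fun X Y Z g f => comp g f)
    (fun X Y Z U h g f => compA h g f)
    (fun X Y f => comp1m f)
    (fun X Y f => compm1 f)
    (fun X Y Z g g' f => compDl g g' f)
    (fun X Y Z g f f' => compDr g f f').

Section Subobjects.
Variable C : preaddCat.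

Record subobj (M : C) := Subobj {
  sub_dom : C; sub_map : hom sub_dom M; sub_mono : mono sub_map }.

Record quotobj (M : C) := Quotobj {
  quot_cod : C; quot_map : hom M quot_cod; quot_epi : epi quot_map }.

(* The subquotient U -> sq_quot of M, for the subobject U = sq_sub of M. *)
Record subquot (M : C) := Subquot {
  sq_sub : subobj M; sq_quot : quotobj (sub_dom sq_sub) }.

Lemma idm_mono (M : C) : mono (idm M).
Proof. by move=> Z g h; rewrite !comp1m. Qed.

Lemma idm_epi (M : C) : epi (idm M).
Proof. by move=> Z g h; rewrite !compm1. Qed.

Definition subobj_id (M : C) : subobj M := Subobj (@idm_mono M).
Definition quotobj_id (M : C) : quotobj M := Quotobj (@idm_epi M).

Definition sub_le (M : C) (U V : subobj M) : Prop :=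
  exists h : hom (sub_dom U) (sub_dom V), sub_map V \oc h = sub_map U.

(* [subobj], [quotobj] and [subquot] are types of representatives; the relations
   below are the equality of the subobjects, factor objects and subquotients. *)
Definition sub_eq (M : C) (U V : subobj M) : Prop :=
  exists phi : hom (sub_dom U) (sub_dom V),
    iso phi /\ sub_map V \oc phi = sub_map U.

Definition quot_eq (M : C) (P Q : quotobj M) : Prop :=
  exists psi : hom (quot_cod P) (quot_cod Q),
    iso psi /\ psi \oc quot_map P = quot_map Q.

Definition subquot_eq (M : C) (A B : subquot M) : Prop :=
  exists (phi : hom (sub_dom (sq_sub A)) (sub_dom (sq_sub B)))
         (psi : hom (quot_cod (sq_quot A)) (quot_cod (sq_quot B))),
    [/\ iso phi, iso psi, sub_map (sq_sub B) \oc phi = sub_map (sq_sub A)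
      & psi \oc quot_map (sq_quot A) = quot_map (sq_quot B) \oc phi].

(* M/U; in an abelian category the default value is never used. *)
Definition quotient (M : C) (U : subobj M) : quotobj M :=
  pick_or (quotobj_id M) (fun Q => is_cokernel (quot_map Q) (sub_map U)).

(* [U], regarded as a subobject of the larger subobject [V] of [M]; the default
   value is used only if [U] is not contained in [V]. *)
Definition sub_in (M : C) (U V : subobj M) : subobj (sub_dom V) :=
  pick_or (subobj_id (sub_dom V)) (fun W =>
    exists phi : hom (sub_dom W) (sub_dom U),
      iso phi /\ sub_map U \oc phi = sub_map V \oc sub_map W).

Definition is_largest_sub (M : C) (P : C -> Prop) (U : subobj M) : Prop :=
  P (sub_dom U) /\ forall V : subobj M, P (sub_dom V) -> sub_le V U.

(* The largest subobject of [M] lying in [P]. If [P] is the torsion class of a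
   torsion pair in an abelian category, the default value is never used. *)
Definition largest_sub (P : C -> Prop) (M : C) : subobj M :=
  pick_or (subobj_id M) (is_largest_sub P).

End Subobjects.

Section Grothendieck.
Variables (R : realType) (C : preaddCat).

Definition K0_rel (r : freemod int C) : Prop :=
  exists (L X N : C) (i : hom L X) (p : hom X N),
    ses i p /\ r = freegen int X - freegen int L - freegen int N.

Definition K0 : zmodType := presented K0_rel.
Definition K0_class (X : C) : K0 := pres_gen K0_rel X.

Definition K0R : lmodType R := tensorZ R K0.
Definition K0R_class (X : C) : K0R := tensorZ1 R (K0_class X).

Lemma K0_class_ses (L X N : C) (i : hom L X) (p : hom X N) :
  ses i p -> K0_class X = K0_class L + K0_class N.
Proof. by move=> ip; apply: pres_pi_rel3; exists L, X, N, i, p. Qed.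

Lemma K0R_class_ses (L X N : C) (i : hom L X) (p : hom X N) :
  ses i p -> K0R_class X = K0R_class L + K0R_class N.
Proof.
move=> ip; rewrite /K0R_class (K0_class_ses ip).
by apply: pres_pi_rel3; exists (K0_class L), (K0_class N).
Qed.

End Grothendieck.

Section TF.
Variables (R : realType) (C : preaddCat).
Implicit Types (theta eta : {scalar K0R R C}) (M X L N : C).

Definition ev theta X : R := theta (K0R_class R X).

Definition Tbar theta X : Prop :=
  forall N (p : hom X N), epi p -> 0 <= ev theta N.

Definition Fcl theta X : Prop :=
  forall L (i : hom L X), mono i -> ~ is_zero L -> ev theta L < 0.

Definition Tcl theta X : Prop :=
  forall N (p : hom X N), epi p -> ~ is_zero N -> 0 < ev theta N.

Definition Fbar theta X : Prop :=
  forall L (i : hom L X), mono i -> ev theta L <= 0.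

Definition Wcl theta X : Prop := Tbar theta X /\ Fbar theta X.

Definition tbar_sub theta M : subobj M := largest_sub (Tbar theta) M.
Definition t_sub theta M : subobj M := largest_sub (Tcl theta) M.
Definition f_quot theta M : quotobj M := quotient (tbar_sub theta M).
Definition w_subquot theta M : subquot M :=
  Subquot (quotient (sub_in (t_sub theta M) (tbar_sub theta M))).
Definition w_obj theta M : C := quot_cod (sq_quot (w_subquot theta M)).

(* Composition factors are taken inside the category W_theta; the result is an
   isomorphism-closed class of objects of [C]. *)
Definition supp theta X (S : C) : Prop :=
  exists (hX : Wcl theta X) (hS : Wcl theta S),
    @composition_factor (full_subcat (Wcl theta))
      (exist _ X hX) (exist _ S hS).

Definition TF_equiv theta eta : Prop :=
  [/\ forall X, Tbar theta X <-> Tbar eta X,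
      forall X, Fcl theta X <-> Fcl eta X,
      forall X, Tcl theta X <-> Tcl eta X
    & forall X, Fbar theta X <-> Fbar eta X].

Definition MTF_equiv M theta eta : Prop :=
  [/\ sub_eq (t_sub theta M) (t_sub eta M),
      subquot_eq (w_subquot theta M) (w_subquot eta M),
      quot_eq (f_quot theta M) (f_quot eta M)
    & forall S : C, supp theta (w_obj theta M) S <-> supp eta (w_obj eta M) S].

End TF.

(* Main.v *)
Require Import Defs.
From mathcomp Require Import all_boot all_order ssralg ssrnum reals.
From Stdlib Require List.
From mathcomp Require Import boolp.

Set Implicit Arguments.
Unset Strict Implicit.
Unset Printing Implicit Defensive.

Import Order.TTheory GRing.Theory Num.Theory.
Local Open Scope ring_scope.

(** Write [t], [tbar] and [w] for the torsion parts and the semistable part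
    attached to [theta].

    Two remarks reduce [M]-TF equivalence to properties of objects.  The
    torsion parts of [M] for [theta] and [eta] agree if and only if each of them
    lies in the other torsion class, because both are largest ([same_torsP]).
    Once both torsion parts agree, the semistable parts are isomorphic and only
    their supports remain to be compared ([w_subquot_eq], [MTF_equivP]).

    (a) The torsion part and the torsion-free quotient of a torsion pair are
    additive functors ([tors_seq_biproduct]), so they send a biproduct to a
    biproduct, and a torsion class contains a biproduct if and only if it
    contains the summands.  This settles the torsion parts.  As [w M] is the
    torsion-free quotient of [tbar M] for the pair (Tcl, Fbar) ([w_seq]), it is
    a biproduct of [w M1] and [w M2], and its support is the union of theirs
    ([supp_w_biproduct]).  The union does not determine its two pieces, so one
    more argument is needed to pass from [M] to a summand [N].  The composition
    factors of [w N] for [theta] occur in the common support of [w M], hence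
    are simple in the category of [eta]-semistable objects.  That category is
    closed under extensions, so the composition series of [w N] for [theta] is
    also one for [eta] ([wide_factor_transfer], [supp_w_transfer]).

    (b) TF equivalent [theta] and [eta] have the same classes, hence the same
    torsion parts and supports.  Conversely, if some object is in the torsion
    class [T] of [theta] but not in the torsion class [T'] of [eta], its
    [eta]-torsion-free quotient is a nonzero object of [T] and [F'].  A nonzero
    object of least length in [T] and [F'] is a brick ([torsion_le_bricks]); it
    equals its torsion part for [theta], whereas its torsion part for [eta] is
    zero.  So if [theta] and [eta] are [B]-TF equivalent for every brick [B],
    they have the same torsion classes, and these determine the torsion-free
    classes.

    The foundations are as follows.  Composition series can be split and
    concatenated along short exact sequences ([comp_series_split],
    [comp_series_cat]); the least length of a composition series is then
    superadditive, which is enough for all inductions on length.  For the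
    weights that count as positive taken to be either the nonnegative or the
    positive reals, one argument produces both torsion pairs of [theta]
    ([stable_torsion_pair]): an object that is not torsion-free has a nonzero
    torsion subobject ([destabilizing_sub]), and splitting such subobjects off
    repeatedly gives the torsion part.  Finally the semistable objects form a
    wide subcategory ([Wcl_wide]), and a wide subcategory of an abelian length
    category is again one ([wide_length_category]), so the results on
    composition series apply inside it. *)

(* From here on compA and sub_map are the categorical notions. *)
Import Defs.

(** * Preadditive categories *)

Section Preadditive.
Variable C : preaddCat.
Implicit Types X Y Z L M N S : C.

Lemma comp0m X Y Z (f : hom X Y) : (0 : hom Y Z) \oc f = 0.
Proof. by apply: (addrI (0 \oc f)); rewrite -compDl !addr0. Qed.

Lemma compm0 X Y Z (g : hom Y Z) : g \oc (0 : hom X Y) = 0.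
Proof. by apply: (addrI (g \oc 0)); rewrite -compDr !addr0. Qed.

Lemma compNm X Y Z (g : hom Y Z) (f : hom X Y) : (- g) \oc f = - (g \oc f).
Proof. by apply/eqP; rewrite -addr_eq0 -compDl addNr comp0m. Qed.

Lemma compmN X Y Z (g : hom Y Z) (f : hom X Y) : g \oc (- f) = - (g \oc f).
Proof. by apply/eqP; rewrite -addr_eq0 -compDr addNr compm0. Qed.

Lemma mono0P X Y (f : hom X Y) :
  mono f <-> forall Z (g : hom Z X), f \oc g = 0 -> g = 0.
Proof.
split=> [fm Z g fg0|f0 Z g h fgh]; first by apply: fm; rewrite fg0 compm0.
by apply/eqP; rewrite -subr_eq0; apply/eqP/f0; rewrite compDr compmN fgh subrr.
Qed.

Lemma epi0P X Y (f : hom X Y) :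
  epi f <-> forall Z (g : hom Y Z), g \oc f = 0 -> g = 0.
Proof.
split=> [fm Z g fg0|f0 Z g h fgh]; first by apply: fm; rewrite fg0 comp0m.
by apply/eqP; rewrite -subr_eq0; apply/eqP/f0; rewrite compDl compNm fgh subrr.
Qed.

Lemma mono_comp X Y Z (g : hom Y Z) (f : hom X Y) :
  mono g -> mono f -> mono (g \oc f).
Proof. by move=> gm fm W a b; rewrite -!compA => /gm /fm. Qed.

Lemma epi_comp X Y Z (g : hom Y Z) (f : hom X Y) :
  epi g -> epi f -> epi (g \oc f).
Proof. by move=> gm fm W a b; rewrite !compA => /fm /gm. Qed.

Lemma mono_compr X Y Z (g : hom Y Z) (f : hom X Y) : mono (g \oc f) -> mono f.
Proof. by move=> gfm W a b fab; apply: gfm; rewrite -!compA fab. Qed.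

Lemma epi_compl X Y Z (g : hom Y Z) (f : hom X Y) : epi (g \oc f) -> epi g.
Proof. by move=> gfm W a b fab; apply: gfm; rewrite !compA fab. Qed.

Lemma retract_epi X Y (g : hom X Y) (f : hom Y X) : g \oc f = idm Y -> epi g.
Proof. by move=> gf; apply: (@epi_compl _ _ _ g f); rewrite gf; exact: idm_epi. Qed.

Lemma section_mono X Y (g : hom X Y) (f : hom Y X) : g \oc f = idm Y -> mono f.
Proof. by move=> gf; apply: (@mono_compr _ _ _ g f); rewrite gf; exact: idm_mono. Qed.

Lemma iso_mono X Y (f : hom X Y) : iso f -> mono f.
Proof. by case=> g [gf _]; exact: section_mono gf. Qed.

Lemma iso_epi X Y (f : hom X Y) : iso f -> epi f.
Proof. by case=> g [_ fg]; exact: retract_epi fg. Qed.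

Lemma iso_id X : iso (idm X).
Proof. by exists (idm X); rewrite comp1m. Qed.

Lemma iso_comp X Y Z (g : hom Y Z) (f : hom X Y) :
  iso g -> iso f -> iso (g \oc f).
Proof.
case=> g' [g'g gg'] [f' [f'f ff']]; exists (f' \oc g'); split.
  by rewrite compA -(compA f') g'g compm1.
by rewrite compA -(compA g) ff' compm1.
Qed.

Lemma isomorphic_sym X Y : isomorphic X Y -> isomorphic Y X.
Proof. by case=> f [g [gf fg]]; exists g, f. Qed.

Lemma is_zeroP X : is_zero X <-> idm X = 0.
Proof.
split=> [[zX _]|X0]; first exact: zX.
by split=> Y f; [rewrite -(compm1 f)|rewrite -(comp1m f)];
   rewrite X0 ?compm0 ?comp0m.
Qed.

Lemma mono_zero X Y (f : hom X Y) : mono f -> is_zero Y -> is_zero X.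
Proof. by move=> fm [_ Y0]; apply/is_zeroP/fm; rewrite compm0; exact: Y0. Qed.

Lemma epi_zero X Y (f : hom X Y) : epi f -> is_zero X -> is_zero Y.
Proof. by move=> fe [X0 _]; apply/is_zeroP/fe; rewrite comp0m; exact: X0. Qed.

Lemma zero_mono X Y (f : hom X Y) : is_zero X -> mono f.
Proof. by case=> _ X0 Z g h _; rewrite (X0 _ g) (X0 _ h). Qed.

(** ** Kernels, cokernels and short exact sequences *)

Lemma kernel_mono L X Y (k : hom L X) (f : hom X Y) : is_kernel k f -> mono k.
Proof.
case=> fk ku; apply/mono0P => Z g kg0.
have [h [_ hu]] := ku Z 0 (compm0 _ f).
by rewrite -(hu g kg0) (hu 0) ?compm0.
Qed.

Lemma cokernel_epi X Y N (c : hom Y N) (f : hom X Y) : is_cokernel c f -> epi c.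
Proof.
case=> cf cu; apply/epi0P => Z g gc0.
have [h [_ hu]] := cu Z 0 (comp0m _ f).
by rewrite -(hu g gc0) (hu 0) ?comp0m.
Qed.

Lemma kernel_lift L X Y (k : hom L X) (f : hom X Y) Z (g : hom Z X) :
  is_kernel k f -> f \oc g = 0 -> exists h, k \oc h = g.
Proof. by case=> _ ku /ku[h [kh _]]; exists h. Qed.

Lemma cokernel_desc X Y N (c : hom Y N) (f : hom X Y) Z (g : hom Y Z) :
  is_cokernel c f -> g \oc f = 0 -> exists h, h \oc c = g.
Proof. by case=> _ ku /ku[h [kh _]]; exists h. Qed.

Lemma is_kernelI L X Y (k : hom L X) (f : hom X Y) :
  mono k -> f \oc k = 0 ->
  (forall Z (g : hom Z X), f \oc g = 0 -> exists h, k \oc h = g) ->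
  is_kernel k f.
Proof.
move=> km fk kf; split=> // Z g /kf[h kh]; exists h; split=> // h' kh'.
by apply: km; rewrite kh.
Qed.

Lemma is_cokernelI X Y N (c : hom Y N) (f : hom X Y) :
  epi c -> c \oc f = 0 ->
  (forall Z (g : hom Y Z), g \oc f = 0 -> exists h, h \oc c = g) ->
  is_cokernel c f.
Proof.
move=> km fk kf; split=> // Z g /kf[h kh]; exists h; split=> // h' kh'.
by apply: km; rewrite kh.
Qed.

Section Ses.
Variables (L X N : C) (i : hom L X) (p : hom X N).
Hypothesis ip : ses i p.

Lemma ses_mono : mono i. Proof. exact: kernel_mono ip.1. Qed.
Lemma ses_epi : epi p. Proof. exact: cokernel_epi ip.2. Qed.
Lemma ses_comp0 : p \oc i = 0. Proof. by case: ip => -[]. Qed.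

Lemma ses_lift Z (g : hom Z X) : p \oc g = 0 -> exists h, i \oc h = g.
Proof. exact: kernel_lift ip.1. Qed.

Lemma ses_desc Z (g : hom X Z) : g \oc i = 0 -> exists h, h \oc p = g.
Proof. exact: cokernel_desc ip.2. Qed.

Lemma ses_zero_mid : is_zero L -> is_zero N -> is_zero X.
Proof.
move=> [L0 _] [_ N0]; have [|h hi] := @ses_lift X (idm X); first exact: N0.
by apply/is_zeroP; rewrite -hi (L0 _ i) comp0m.
Qed.

Lemma ses_iso_sub : is_zero N -> iso i.
Proof.
move=> [_ N0]; have [|h ih] := @ses_lift X (idm X); first exact: N0.
exists h; split=> //; apply: ses_mono; by rewrite compA ih comp1m compm1.
Qed.

Lemma ses_iso_quot : is_zero L -> iso p.
Proof.
move=> [L0 _]; have [|h hp] := @ses_desc X (idm X).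
  by rewrite (L0 _ i) compm0.
exists h; split=> //; apply: ses_epi; by rewrite -compA hp comp1m compm1.
Qed.

End Ses.

Lemma ses_isor L X Y N (i : hom L X) (p : hom X N) (f : hom X Y) (g : hom Y X) :
  g \oc f = idm X -> f \oc g = idm Y -> ses i p -> ses (f \oc i) (p \oc g).
Proof.
move=> gf fg ip; split.
  apply: is_kernelI.
  - by apply: mono_comp; [exact: section_mono gf|exact: ses_mono ip].
  - by rewrite compA -(compA p) gf compm1 (ses_comp0 ip).
  - move=> Z h; rewrite -compA => /(ses_lift ip)[k ik]; exists k.
    by rewrite -compA ik compA fg comp1m.
apply: is_cokernelI.
- by apply: epi_comp; [exact: ses_epi ip|exact: retract_epi gf].
- by rewrite compA -(compA p) gf compm1 (ses_comp0 ip).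
- move=> Z h; rewrite compA => /(ses_desc ip)[k ik]; exists k.
  by rewrite compA ik -compA fg compm1.
Qed.

Lemma ses_zero_id Z X : is_zero Z -> @ses C Z X X 0 (idm X).
Proof.
move=> Z0; split.
  apply: is_kernelI; [exact: zero_mono|by rewrite compm0|].
  by move=> W g; rewrite comp1m => ->; exists 0; rewrite compm0.
apply: is_cokernelI; [exact: idm_epi|by rewrite compm0|].
by move=> W g _; exists g; rewrite compm1.
Qed.

Lemma ses_biproduct M1 M2 M (i1 : hom M1 M) (i2 : hom M2 M)
    (p1 : hom M M1) (p2 : hom M M2) :
  is_biproduct i1 i2 p1 p2 -> ses i1 p2.
Proof.
case=> e11 e22 _ e21 e; split.
  apply: is_kernelI => //; first exact: section_mono e11.
  move=> Z g p2g; exists (p1 \oc g).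
  by rewrite -[RHS]comp1m -e compDl -!compA p2g compm0 addr0.
apply: is_cokernelI => //; first exact: retract_epi e22.
move=> Z g gi1; exists (g \oc i2).
by rewrite -[RHS]compm1 -e compDr !compA gi1 comp0m add0r.
Qed.

(** An isomorphism of middle terms that matches the subobjects matches the
    factor objects as well. *)
Lemma ses_iso_desc L X N L' X' N' (i : hom L X) (p : hom X N)
    (i' : hom L' X') (p' : hom X' N') (f : hom X X') (g : hom X' X) :
  ses i p -> ses i' p' -> g \oc f = idm X -> f \oc g = idm X' ->
  (exists h, i' \oc h = f \oc i) -> (exists h, i \oc h = g \oc i') ->
  exists h : hom N N', iso h /\ h \oc p = p' \oc f.
Proof.
move=> ip ip' gf fg [a ea] [b eb].
have [|h hp] := ses_desc ip (g := p' \oc f).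
  by rewrite -compA -ea compA (ses_comp0 ip') comp0m.
have [|k kp] := ses_desc ip' (g := p \oc g).
  by rewrite -compA -eb compA (ses_comp0 ip) comp0m.
exists h; split=> //; exists k; split.
  by apply: (ses_epi ip); rewrite -compA hp compA kp -compA gf compm1 comp1m.
by apply: (ses_epi ip'); rewrite -compA kp compA hp -compA fg compm1 comp1m.
Qed.

Lemma simple_iso S S' : isomorphic S S' -> simple S -> simple S'.
Proof.
case=> f fi [S0 Ss]; split; first by move/(mono_zero (iso_mono fi)).
case: (fi) => g [gf fg] L i im.
have gm : mono g by exact: section_mono fg.
case: (Ss L (g \oc i) (mono_comp gm im)); [by left|right].
by rewrite -(comp1m i) -fg -compA; exact: iso_comp.
Qed.

Lemma comp_series_iso X Y s :
  isomorphic X Y -> comp_series X s -> comp_series Y s.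
Proof.
case=> f + Xs; case: Xs f => [Z Z0 f fi|L Z S i p s' ip Ss Ls f [g [gf fg]]].
  by apply: comp_series_zero; exact: epi_zero (iso_epi fi) Z0.
exact: comp_series_cons (ses_isor gf fg ip) Ss Ls.
Qed.

Lemma comp_series_simple X s S : comp_series X s -> List.In S s -> simple S.
Proof. by elim=> // L {}X S' i p s' _ S's _ IH /= [<-|/IH]. Qed.

End Preadditive.

(** * Abelian categories *)

Section Abelian.
Variables (C : preaddCat) (hC : abelian C).
Implicit Types X Y Z L M N S : C.

Lemma mono_ses L X (i : hom L X) : mono i -> exists N (p : hom X N), ses i p.
Proof.
move=> im; have [Z [g ig]] := ab_mono hC im.
have [N [c ci]] := ab_cokernel hC i; exists N, c; split=> //.
apply: is_kernelI => [//||W x cx]; first exact: ci.1.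
have [t tc] := cokernel_desc ci ig.1.
by apply: (kernel_lift ig); rewrite -tc -compA cx compm0.
Qed.

Lemma epi_ses X N (p : hom X N) : epi p -> exists L (i : hom L X), ses i p.
Proof.
move=> pe; have [Z [g pg]] := ab_epi hC pe.
have [L [k kp]] := ab_kernel hC p; exists L, k; split=> //.
apply: is_cokernelI => [//||W x xk]; first exact: kp.1.
have [t kt] := kernel_lift kp pg.1.
by apply: (cokernel_desc pg); rewrite -kt compA xk comp0m.
Qed.

Lemma kernel_epi_ses L X N (k : hom L X) (p : hom X N) :
  is_kernel k p -> epi p -> ses k p.
Proof.
move=> kp /epi_ses[L' [k' k'p]]; split=> //.
apply: is_cokernelI => [||W x xk]; [exact: ses_epi k'p|exact: kp.1|].
have [t kt] := kernel_lift kp (ses_comp0 k'p).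
by apply: (ses_desc k'p); rewrite -kt compA xk comp0m.
Qed.

Lemma mono_cokernel_ses L X N (i : hom L X) (c : hom X N) :
  mono i -> is_cokernel c i -> ses i c.
Proof.
move=> /mono_ses[N' [c' ic']] ci; split=> //.
apply: is_kernelI => [||W x cx]; [exact: ses_mono ic'|exact: ci.1|].
have [t tc] := cokernel_desc ci (ses_comp0 ic').
by apply: (ses_lift ic'); rewrite -tc -compA cx compm0.
Qed.

(** The image is the kernel of the cokernel.  A map killing the corestriction
    of [f] has a kernel through which [f] factors, and that kernel cannot be a
    proper subobject of the image since it is itself the kernel of a map
    vanishing on [f]. *)
Lemma image_factor X Y (f : hom X Y) :
  exists I (m : hom I Y) (e : hom X I), [/\ mono m, epi e & f = m \oc e].
Proof.
have [N [c cf]] := ab_cokernel hC f; have [I [m mc]] := ab_kernel hC c.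
have mm := kernel_mono mc; have [e me] := kernel_lift mc cf.1.
exists I, m, e; split=> //; apply/epi0P => Z g ge.
have [J [j jg]] := ab_kernel hC g; have [e' je'] := kernel_lift jg ge.
have [D [d jd]] := mono_ses (mono_comp mm (kernel_mono jg)).
have [|d' d'c] := @cokernel_desc _ _ _ _ c f _ d cf.
  by rewrite -me -je' (compA m) compA (ses_comp0 jd) comp0m.
have [|t jt] := ses_lift jd (g := m); first by rewrite -d'c -compA mc.1 compm0.
have {}jt : j \oc t = idm I by apply: mm; rewrite compA jt compm1.
by rewrite -(compm1 g) -jt compA jg.1 comp0m.
Qed.

(** Pulling back an extension of [N] along a subobject [N'] of [N]: the
    preimage of [N'] is an extension of [N'] by the same kernel. *)
Lemma ses_preimage L X X' N N' N'' (i : hom L X) (p : hom X N)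
    (j : hom N' N) (c : hom N N'') (k : hom X' X) :
  ses i p -> ses j c -> ses k (c \oc p) ->
  exists (l : hom L X') (q : hom X' N'), ses l q.
Proof.
move=> ip jc kcp.
have [|q jq] := ses_lift jc (g := p \oc k).
  by rewrite compA (ses_comp0 kcp).
have [|l kl] := ses_lift kcp (g := i).
  by rewrite -compA (ses_comp0 ip) compm0.
exists l, q; apply: kernel_epi_ses.
  apply: is_kernelI.
  - by apply: (@mono_compr _ _ _ _ k); rewrite kl; exact: ses_mono ip.
  - by apply: (ses_mono jc); rewrite compA jq -compA kl compm0 (ses_comp0 ip).
  - move=> Z x qx; have [|y iy] := ses_lift ip (g := k \oc x).
      by rewrite compA -jq -compA qx compm0.
    by exists y; apply: (ses_mono kcp); rewrite compA kl.
have [I [m [e [mm ee qE]]]] := image_factor q.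
have [D [d jmd]] := mono_ses (mono_comp (ses_mono jc) mm).
have [|t tcp] := ses_desc kcp (g := d \oc p).
  by rewrite -compA -jq qE !compA -(compA d) (ses_comp0 jmd) comp0m.
have {}tcp : t \oc c = d by apply: (ses_epi ip); rewrite -compA.
have [|s js] := ses_lift jmd (g := j).
  by rewrite -tcp -compA (ses_comp0 jc) compm0.
rewrite qE; apply: epi_comp => //; apply: (@retract_epi _ _ _ _ s).
by apply: (ses_mono jc); rewrite compA js compm1.
Qed.

(** ** Composition series *)

(** Intersecting a composition series of [X] with [L] and projecting it to [N]
    sends every composition factor to exactly one of the two sides. *)
Lemma comp_series_split X s : comp_series X s ->
  forall L N (i : hom L X) (p : hom X N), ses i p ->
  exists s1 s2, [/\ comp_series L s1, comp_series N s2,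
    size s = (size s1 + size s2)%N
    & forall S, List.In S s -> List.In S s1 \/ List.In S s2].
Proof.
elim=> {X s} [X X0|X' X S i' p' s ip' Ss _ IH] L N i p ip.
  exists [::], [::]; split=> //; apply: comp_series_zero.
    exact: mono_zero (ses_mono ip) X0.
  exact: epi_zero (ses_epi ip) X0.
have [I [m [e [mm ee pi]]]] := image_factor (p' \oc i).
(* The simple top factor of [X] comes from [N] if [L] maps to zero in it, and
   from [L] otherwise. *)
case: (Ss.2 I m mm) => [I0|mi].
  have pi0 : p' \oc i = 0 by rewrite pi (I0.1 _ m) comp0m.
  have [t tp] := ses_desc ip pi0.
  have te : epi t by apply: (@epi_compl _ _ _ _ _ p); rewrite tp; exact: ses_epi ip'.
  have [K [j jt]] := epi_ses te.
  have [|l [q lq]] := ses_preimage ip jt (k := i'); first by rewrite tp.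
  have [s1 [s2 [H1 H2 sz H]]] := IH _ _ _ _ lq.
  exists s1, (S :: s2); split=> //; first exact: comp_series_cons jt Ss H2.
    by rewrite /= sz addnS.
  by move=> S' /= [->|/H[]]; tauto.
have pie : epi (p' \oc i) by rewrite pi; apply: epi_comp => //; exact: iso_epi mi.
have [L' [l lp]] := epi_ses pie.
have [|l' il'] := ses_lift ip' (g := i \oc l).
  by rewrite compA (ses_comp0 lp).
have lq : ses l' (p \oc i').
  apply: kernel_epi_ses.
    apply: is_kernelI.
    - apply: (@mono_compr _ _ _ _ i'); rewrite il'.
      by apply: mono_comp; [exact: ses_mono ip|exact: ses_mono lp].
    - by rewrite -compA il' compA (ses_comp0 ip) comp0m.
    - move=> Z x; rewrite -compA => /(ses_lift ip)[y iy].
      have [|z lz] := ses_lift lp (g := y).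
        by rewrite -compA iy compA (ses_comp0 ip') comp0m.
      by exists z; apply: (ses_mono ip'); rewrite compA il' -compA lz.
  apply/epi0P => Z g; rewrite compA => /(ses_desc ip')[h hp].
  have h0 : h = 0.
    apply: pie; rewrite comp0m compA hp -compA (ses_comp0 ip) compm0 //.
  by apply: (ses_epi ip); rewrite -hp h0 !comp0m.
have [s1 [s2 [H1 H2 sz H]]] := IH _ _ _ _ lq.
exists (S :: s1), s2; split=> //; first exact: comp_series_cons lp Ss H1.
  by rewrite /= sz.
by move=> S' /= [->|/H[]]; tauto.
Qed.

Lemma comp_series_cat L s1 N s2 : comp_series L s1 -> comp_series N s2 ->
  forall X (i : hom L X) (p : hom X N), ses i p -> comp_series X (s2 ++ s1).
Proof.
move=> H1; elim=> {N s2} [N N0|N' N S j c s2 jc Ss _ IH] X i p ip /=.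
  by apply: comp_series_iso H1; exists i; exact: ses_iso_sub ip N0.
have [X' [k kcp]] := epi_ses (epi_comp (ses_epi jc) (ses_epi ip)).
have [l [q lq]] := ses_preimage ip jc kcp.
exact: comp_series_cons kcp Ss (IH _ _ _ lq).
Qed.

End Abelian.

Section Length.
Variables (C : preaddCat) (hC : length_category C).
Implicit Types X Y Z L M N S : C.

Lemma has_length X :
  exists n, `[< exists s, comp_series X s /\ size s = n >].
Proof. by have [s Xs] := hC.2 X; exists (size s); apply/asboolP; exists s. Qed.

(** Defined as the least length of a composition series; [len_ses] is the only
    additivity needed, so that the Jordan-Hoelder theorem can be avoided. *)
Definition len X : nat := ex_minn (has_length X).

Lemma len_series X : exists s, comp_series X s /\ size s = len X.
Proof. by rewrite /len; case: ex_minnP => n /asboolP. Qed.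

Lemma len_le X s : comp_series X s -> (len X <= size s)%N.
Proof.
by move=> Xs; rewrite /len; case: ex_minnP => n _; apply; apply/asboolP; exists s.
Qed.

Lemma len0_zero X : len X = 0%N -> is_zero X.
Proof.
have [s [Xs <-]] := len_series X; case: Xs => // L {}X S i p s' _ _ _ //.
Qed.

Lemma len_ses L X N (i : hom L X) (p : hom X N) :
  ses i p -> (len L + len N <= len X)%N.
Proof.
move=> ip; have [s [Xs <-]] := len_series X.
have [s1 [s2 [H1 H2 -> _]]] := comp_series_split hC.1 Xs ip.
exact: leq_add (len_le H1) (len_le H2).
Qed.

Lemma len_gt0 X : ~ is_zero X -> (0 < len X)%N.
Proof. by move=> X0; rewrite lt0n; apply/eqP => /len0_zero. Qed.

Lemma min_len_mono L X (i : hom L X) : mono i -> (len X <= len L)%N -> iso i.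
Proof.
move=> /(mono_ses hC.1)[N [p ip]] XL; apply: (ses_iso_sub ip).
apply: contrapT => /len_gt0; have := leq_trans (len_ses ip) XL.
by rewrite -[X in (_ <= X)%N]addn0 leq_add2l leqn0 => /eqP->.
Qed.

Lemma min_len_epi X N (p : hom X N) : epi p -> (len X <= len N)%N -> iso p.
Proof.
move=> /(epi_ses hC.1)[L [i ip]] XN; apply: (ses_iso_quot ip).
apply: contrapT => /len_gt0; have := leq_trans (len_ses ip) XN.
by rewrite -[X in (_ <= X)%N]add0n leq_add2r leqn0 => /eqP->.
Qed.

Lemma exists_min_len (P : C -> Prop) : (exists X, P X) ->
  exists X, P X /\ forall Y, P Y -> (len X <= len Y)%N.
Proof.
move=> [X0 PX0]; have ex : exists n, `[< exists X, P X /\ len X = n >].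
  by exists (len X0); apply/asboolP; exists X0.
case: (ex_minnP ex) => n /asboolP[X [PX <-]] min; exists X; split=> // Y PY.
by apply: min; apply/asboolP; exists Y.
Qed.

End Length.

(** * Torsion pairs *)

Section TorsionPairs.
Variables (C : preaddCat) (hC : abelian C).
Implicit Types X Y Z L M N U : C.

Definition tors_seq (T F : C -> Prop) U X Y (u : hom U X) (q : hom X Y) : Prop :=
  [/\ ses u q, T U & F Y].

Record torsion_pair (T F : C -> Prop) : Prop := TorsionPair {
  torsP : forall X, T X <-> forall Y, F Y -> forall f : hom X Y, f = 0;
  tfreeP : forall Y, F Y <-> forall X, T X -> forall f : hom X Y, f = 0;
  tors_dec : forall X, exists U Y (u : hom U X) (q : hom X Y), tors_seq T F u q }.

(** An object with no nonzero map to [F] is isomorphic to its own torsion part,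
    so orthogonality and the decomposition already give a torsion pair. *)
Lemma torsion_pairI (T F : C -> Prop) :
  (forall X N (p : hom X N), epi p -> T X -> T N) ->
  (forall L X (i : hom L X), mono i -> F X -> F L) ->
  (forall X Y (f : hom X Y), T X -> F Y -> f = 0) ->
  (forall X, exists U Y (u : hom U X) (q : hom X Y), tors_seq T F u q) ->
  torsion_pair T F.
Proof.
move=> Tq Fs TF0 dec; split=> // X.
  split=> [TX Y FY f|X0]; first exact: TF0.
  have [U [Y [u [q [uq TU FY]]]]] := dec X; apply: Tq TU.
  apply: iso_epi; apply: (ses_iso_sub uq); apply/is_zeroP/(ses_epi uq).
  by rewrite comp0m comp1m; exact: X0.
split=> [FX Y TY f|X0]; first exact: TF0.
have [U [Y [u [q [uq TU FY]]]]] := dec X; apply: Fs FY.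
apply: iso_mono; apply: (ses_iso_quot uq); apply/is_zeroP/(ses_mono uq).
by rewrite compm0 compm1; exact: X0.
Qed.

Section Pair.
Variables (T F : C -> Prop) (TF : torsion_pair T F).

Lemma tors_quot X N (p : hom X N) : epi p -> T X -> T N.
Proof.
move=> pe /(torsP TF) TX; apply/(torsP TF) => Y FY f.
by apply: pe; rewrite comp0m; exact: TX.
Qed.

Lemma tfree_sub L X (i : hom L X) : mono i -> F X -> F L.
Proof.
move=> im /(tfreeP TF) FX; apply/(tfreeP TF) => Y TY f.
by apply: im; rewrite compm0; exact: FX.
Qed.

Lemma tors_iso X Y : isomorphic X Y -> T X -> T Y.
Proof. by case=> f /iso_epi; exact: tors_quot. Qed.

Lemma tfree_iso X Y : isomorphic X Y -> F X -> F Y.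
Proof. by move/isomorphic_sym=> [f /iso_mono]; exact: tfree_sub. Qed.

Lemma tors_ext L X N (i : hom L X) (p : hom X N) : ses i p -> T L -> T N -> T X.
Proof.
move=> ip /(torsP TF) TL /(torsP TF) TN; apply/(torsP TF) => Y FY f.
have [|h <-] := ses_desc ip (g := f); first exact: TL.
by rewrite (TN _ FY h) comp0m.
Qed.

Lemma tfree_ext L X N (i : hom L X) (p : hom X N) : ses i p -> F L -> F N -> F X.
Proof.
move=> ip /(tfreeP TF) TL /(tfreeP TF) TN; apply/(tfreeP TF) => Y FY f.
have [|h <-] := ses_lift ip (g := f); first exact: TN.
by rewrite (TL _ FY h) compm0.
Qed.

Lemma tors_tfree0 X : T X -> F X -> is_zero X.
Proof. by move=> /(torsP TF) TX FX; apply/is_zeroP; exact: TX. Qed.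

Section Sequence.
Variables (U X Y : C) (u : hom U X) (q : hom X Y).
Hypothesis uq : tors_seq T F u q.

Lemma tors_seq_lift Z (f : hom Z X) : T Z -> exists h, u \oc h = f.
Proof.
case: (uq) => uq' _ FY /(torsP TF) TZ; apply: (ses_lift uq'); exact: TZ.
Qed.

Lemma tors_seq_desc Z (f : hom X Z) : F Z -> exists h, h \oc q = f.
Proof.
case: (uq) => uq' TU _ /(tfreeP TF) FZ; apply: (ses_desc uq'); exact: FZ.
Qed.

End Sequence.

Lemma largest_tors_exists M : exists U : subobj M, is_largest_sub T U.
Proof.
have [U [Y [u [q uq]]]] := tors_dec TF M; case: (uq) => uq' TU FY.
exists (Subobj (ses_mono uq')); split=> //= V TV.
by have [h hu] := tors_seq_lift uq (sub_map V) TV; exists h.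
Qed.

Lemma largest_lift M (U : subobj M) Z (f : hom Z M) :
  is_largest_sub T U -> T Z -> exists h, sub_map U \oc h = f.
Proof.
case=> TU Umax TZ; have [I [m [e [mm ee ->]]]] := image_factor hC f.
have [h hm] := Umax (Subobj mm) (tors_quot ee TZ).
by exists (h \oc e); rewrite compA hm.
Qed.

Lemma largest_tors_seq M (U : subobj M) Q (q : hom M Q) :
  is_largest_sub T U -> ses (sub_map U) q -> tors_seq T F (sub_map U) q.
Proof.
move=> Ul Uq; split=> //; first by case: Ul.
have [U' [Y [u [q' uq']]]] := tors_dec TF M; case: (uq') => ses' TU' FY.
have [h hu] := largest_lift u Ul TU'.
have [k ku] := tors_seq_lift uq' (sub_map U) Ul.1.
have [g [gi _]] : exists g : hom Y Q, iso g /\ g \oc q' = q \oc idm M.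
  apply: (ses_iso_desc ses' Uq (comp1m _) (comp1m _)).
    by exists h; rewrite comp1m.
  by exists k; rewrite comp1m.
by apply: tfree_iso FY; exists g.
Qed.

(** The torsion part and the torsion-free quotient are additive functors:
    each structure map of the biproduct restricts to the torsion parts and
    descends to the quotients, and so do the biproduct identities. *)
Lemma tors_seq_biproduct M1 M2 M (i1 : hom M1 M) (i2 : hom M2 M)
    (p1 : hom M M1) (p2 : hom M M2)
    U U1 U2 Y Y1 Y2 (u : hom U M) (q : hom M Y) (u1 : hom U1 M1)
    (q1 : hom M1 Y1) (u2 : hom U2 M2) (q2 : hom M2 Y2) :
  is_biproduct i1 i2 p1 p2 ->
  tors_seq T F u q -> tors_seq T F u1 q1 -> tors_seq T F u2 q2 ->
  (exists (a1 : hom U1 U) (a2 : hom U2 U) (b1 : hom U U1) (b2 : hom U U2),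
     is_biproduct a1 a2 b1 b2) /\
  (exists (a1 : hom Y1 Y) (a2 : hom Y2 Y) (b1 : hom Y Y1) (b2 : hom Y Y2),
     is_biproduct a1 a2 b1 b2).
Proof.
case=> e11 e22 e12 e21 e uq uq1 uq2.
have [[s TU FY] [s1 TU1 FY1] [s2 TU2 FY2]] := And3 uq uq1 uq2.
have [um u1m u2m] := And3 (ses_mono s) (ses_mono s1) (ses_mono s2).
have [qe q1e q2e] := And3 (ses_epi s) (ses_epi s1) (ses_epi s2).
split.
  have [a1 ea1] := tors_seq_lift uq (i1 \oc u1) TU1.
  have [a2 ea2] := tors_seq_lift uq (i2 \oc u2) TU2.
  have [b1 eb1] := tors_seq_lift uq1 (p1 \oc u) TU.
  have [b2 eb2] := tors_seq_lift uq2 (p2 \oc u) TU.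
  exists a1, a2, b1, b2; split.
  - by apply: u1m; rewrite compA eb1 -compA ea1 compA e11 compm1 comp1m.
  - by apply: u2m; rewrite compA eb2 -compA ea2 compA e22 compm1 comp1m.
  - by apply: u1m; rewrite compA eb1 -compA ea2 compA e12 compm0 comp0m.
  - by apply: u2m; rewrite compA eb2 -compA ea1 compA e21 compm0 comp0m.
  - apply: um; rewrite compDr !compA ea1 ea2 -!compA eb1 eb2 !compA -compDl e.
    by rewrite compm1 comp1m.
have [a1 ea1] := tors_seq_desc uq1 (q \oc i1) FY.
have [a2 ea2] := tors_seq_desc uq2 (q \oc i2) FY.
have [b1 eb1] := tors_seq_desc uq (q1 \oc p1) FY1.
have [b2 eb2] := tors_seq_desc uq (q2 \oc p2) FY2.
exists a1, a2, b1, b2; split.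
- by apply: q1e; rewrite -compA ea1 compA eb1 -compA e11 compm1 comp1m.
- by apply: q2e; rewrite -compA ea2 compA eb2 -compA e22 compm1 comp1m.
- by apply: q2e; rewrite -compA ea2 compA eb1 -compA e12 compm0 comp0m.
- by apply: q1e; rewrite -compA ea1 compA eb2 -compA e21 compm0 comp0m.
- apply: qe; rewrite compDl -!compA eb1 eb2 !compA ea1 ea2 -!compA -compDr e.
  by rewrite compm1 comp1m.
Qed.

Lemma tors_biproduct M1 M2 M (i1 : hom M1 M) (i2 : hom M2 M)
    (p1 : hom M M1) (p2 : hom M M2) :
  is_biproduct i1 i2 p1 p2 -> T M <-> T M1 /\ T M2.
Proof.
move=> b; split=> [TM|[TM1 TM2]]; last exact: tors_ext (ses_biproduct b) TM1 TM2.
case: b => e1 e2 _ _ _.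
by split; apply: tors_quot TM; [exact: retract_epi e1|exact: retract_epi e2].
Qed.

End Pair.

End TorsionPairs.

(** * Semistable torsion pairs *)

Section Stability.
Variables (R : realType) (C : preaddCat) (hC : length_category C).
Implicit Types X Y Z L M N S : C.
Variable theta : {scalar K0R R C}.
Local Notation ev := (ev theta).

Lemma ev_ses L X N (i : hom L X) (p : hom X N) : ses i p -> ev X = ev L + ev N.
Proof. by move=> ip; rewrite /Defs.ev (K0R_class_ses R ip) linearD. Qed.

Lemma ev_zero X : is_zero X -> ev X = 0.
Proof.
move=> X0; apply: (addrI (ev X)).
by rewrite -(ev_ses (ses_zero_id X X0)) addr0.
Qed.

(** The two torsion pairs of [theta] are the instances [pos = (0 <= _)] and
    [pos = (0 < _)] of one construction. *)
Section Positivity.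
Variable pos : R -> Prop.
Hypothesis posD : forall x y, pos x -> pos y -> pos (x + y).
Hypothesis posB : forall x y, pos (x + y) -> ~ pos x -> pos y.

Definition Tpos X : Prop :=
  forall N (p : hom X N), epi p -> ~ is_zero N -> pos (ev N).
Definition Fpos X : Prop :=
  forall L (i : hom L X), mono i -> ~ is_zero L -> ~ pos (ev L).

Lemma Tpos_quot X N (p : hom X N) : epi p -> Tpos X -> Tpos N.
Proof. by move=> pe TX N' p' pe'; apply: TX (epi_comp pe' pe). Qed.

Lemma Fpos_sub L X (i : hom L X) : mono i -> Fpos X -> Fpos L.
Proof. by move=> pe TX N' p' pe'; apply: TX (mono_comp pe pe'). Qed.

(** A factor object of an extension is an extension of a factor object of the
    right-hand term by a factor object of the left-hand term. *)
Lemma Tpos_ext L X N (i : hom L X) (p : hom X N) :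
  ses i p -> Tpos L -> Tpos N -> Tpos X.
Proof.
move=> ip TL TN N' p' pe N'0.
have [I [m [e [mm ee pE]]]] := image_factor hC.1 (p' \oc i).
have [D [d md]] := mono_ses hC.1 mm.
have [|t tp] := ses_desc ip (g := d \oc p').
  by rewrite -compA pE compA (ses_comp0 md) comp0m.
have te : epi t.
  by apply: (@epi_compl _ _ _ _ _ p); rewrite tp; apply: epi_comp (ses_epi md) pe.
rewrite (ev_ses md); have [I0|I0] := pselect (is_zero I).
  rewrite (ev_zero I0) add0r; apply: TN te _ => D0.
  by apply: N'0; exact: ses_zero_mid md I0 D0.
have [D0|D0] := pselect (is_zero D); last by apply: posD; [exact: TL ee _|exact: TN te _].
by rewrite (ev_zero D0) addr0; exact: TL ee _.
Qed.

(** Among the nonzero subobjects of positive weight, one of least length is in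
    [Tpos]: its proper nonzero subobjects are not positive, so that its factor
    objects are at least as positive as the subobject itself. *)
Lemma destabilizing_sub X : ~ Fpos X ->
  exists L (i : hom L X), [/\ mono i, ~ is_zero L & Tpos L].
Proof.
move=> nF.
have [|L [[i [im L0 pL]] Lmin]] := @exists_min_len _ hC (fun L =>
    exists i : hom L X, [/\ mono i, ~ is_zero L & pos (ev L)]).
  apply: contrapT => H; apply: nF => L i im L0 pL; apply: H.
  by exists L, i.
exists L, i; split=> // N p pe N0.
have [K [k kp]] := epi_ses hC.1 pe.
move: pL; rewrite (ev_ses kp).
have [K0|K0] := pselect (is_zero K); first by rewrite (ev_zero K0) add0r.
move/posB; apply=> pK.
have /Lmin : exists k' : hom K X, [/\ mono k', ~ is_zero K & pos (ev K)].
  by exists (i \oc k); split=> //; exact: mono_comp im (ses_mono kp).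
rewrite leqNgt => /negP; apply; apply: leq_trans (len_ses hC kp).
by rewrite -addn1 leq_add2l; exact: len_gt0.
Qed.

(** Split off a nonzero subobject in [Tpos], decompose the shorter factor
    object, and take the preimage of its torsion part. *)
Lemma Tpos_dec X :
  exists U Y (u : hom U X) (q : hom X Y), tors_seq Tpos Fpos u q.
Proof.
have [n] := ubnP (len hC X); elim: n X => // n IH X; rewrite ltnS => Xn.
have [FX|/destabilizing_sub[L [i [im L0 TL]]]] := pselect (Fpos X).
  have [Z Z0] := ab_zero hC.1; exists Z, X, 0, (idm X).
  split=> //; first exact: ses_zero_id.
  by move=> N p pe []; exact: epi_zero pe Z0.
have [N [p ip]] := mono_ses hC.1 im.
have [|U [Y [u [q [uq TU FY]]]]] := IH N.
  apply: leq_trans Xn.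
  apply: leq_trans (len_ses hC ip); rewrite -add1n leq_add2r; exact: len_gt0.
have [V [v vs]] := epi_ses hC.1 (epi_comp (ses_epi uq) (ses_epi ip)).
have [l [r lr]] := ses_preimage hC.1 ip uq vs.
by exists V, Y, v, (q \oc p); split=> //; exact: Tpos_ext lr TL TU.
Qed.

Lemma stable_torsion_pair : torsion_pair Tpos Fpos.
Proof.
apply: (torsion_pairI Tpos_quot Fpos_sub _ Tpos_dec) => X Y f TX FY.
have [I [m [e [mm ee ->]]]] := image_factor hC.1 f.
have [I0|I0] := pselect (is_zero I); first by rewrite (I0.1 _ m) comp0m.
by case: (FY _ _ mm I0); exact: TX ee I0.
Qed.

End Positivity.

Lemma TbarE : Tbar theta = Tpos (fun x => 0 <= x).
Proof.
apply/funext => X; apply/propext; split=> H N p pe; first by move=> _; exact: H pe.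
have [N0|N0] := pselect (is_zero N); first by rewrite (ev_zero N0).
exact: H pe N0.
Qed.

Lemma FclE : Fcl theta = Fpos (fun x => 0 <= x).
Proof.
by apply/funext => X; apply/propext; split=> H L i im L0;
  have := H L i im L0; rewrite ltNge => /negP.
Qed.

Lemma FbarE : Fbar theta = Fpos (fun x => 0 < x).
Proof.
apply/funext => X; apply/propext; split=> H L i im.
  by move=> L0; apply/negP; rewrite -leNgt; exact: H im.
have [L0|L0] := pselect (is_zero L); first by rewrite (ev_zero L0).
by rewrite leNgt; apply/negP; exact: H im L0.
Qed.

Lemma Tbar_Fcl_torsion_pair : torsion_pair (Tbar theta) (Fcl theta).
Proof.
rewrite TbarE FclE; apply: stable_torsion_pair => x y; first exact: addr_ge0.
by move=> xy /negP; rewrite -ltNge => /ltW x0; apply: le_trans xy _; rewrite gerDr.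
Qed.

Lemma Tcl_Fbar_torsion_pair : torsion_pair (Tcl theta) (Fbar theta).
Proof.
rewrite FbarE; apply: stable_torsion_pair => x y; first exact: addr_gt0.
by move=> xy /negP; rewrite -leNgt => x0; apply: lt_le_trans xy _; rewrite gerDr.
Qed.

Lemma Tcl_Tbar X : Tcl theta X -> Tbar theta X.
Proof. by rewrite TbarE => TX N p pe N0; apply: ltW; exact: TX pe N0. Qed.

End Stability.

(** * Bricks between two torsion classes *)

(** A nonzero object of least length in [T] and [F'] is a brick: the image of a
    nonzero endomorphism lies in [T] as a factor object and in [F'] as a
    subobject, hence has full length. *)
Lemma torsion_le_bricks (C : preaddCat) (hC : length_category C)
    (T F T' F' : C -> Prop) :
  torsion_pair T F -> torsion_pair T' F' ->
  (forall B, brick B -> T B -> ~ F' B) -> forall X, T X -> T' X.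
Proof.
move=> TF TF' noB X TX; have [U [Y [u [q [uq TU FY]]]]] := tors_dec TF' X.
have TY : T Y by exact: tors_quot TF _ _ _ (ses_epi uq) TX.
have [Y0|Y0] := pselect (is_zero Y).
  by apply: (tors_iso TF') TU; exists u; exact: ses_iso_sub uq Y0.
exfalso.
have [|B [[B0 TB FB] Bmin]] :=
  @exists_min_len _ hC (fun B => [/\ ~ is_zero B, T B & F' B]); first by exists Y.
apply: (noB B) => //; split=> // f f0.
have [I [m [e [mm ee fE]]]] := image_factor hC.1 f.
have {}Bmin : (len hC B <= len hC I)%N.
  apply: Bmin; split; [|exact: (tors_quot TF ee)|exact: (tfree_sub TF' mm)].
  by move=> I0; apply: f0; rewrite fE (I0.1 _ m) comp0m.
by rewrite fE; apply: iso_comp; [exact: min_len_mono mm Bmin|exact: min_len_epi ee Bmin].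
Qed.

(** * Composition factors in wide subcategories *)

Section CompositionFactors.
Variables (C : preaddCat) (hC : length_category C).
Implicit Types X Y L N S : C.

Lemma composition_factor_ses L X N (i : hom L X) (p : hom X N) S :
  ses i p ->
  composition_factor X S <-> composition_factor L S \/ composition_factor N S.
Proof.
move=> ip; split=> [[s [Xs [S' [sS' S'S]]]]|].
  have [s1 [s2 [H1 H2 _ H]]] := comp_series_split hC.1 Xs ip.
  by case: (H _ sS') => sS''; [left; exists s1|right; exists s2]; split=> //; exists S'.
case=> [[s1 [H1 [S' [sS' S'S]]]]|[s2 [H2 [S' [sS' S'S]]]]].
  have [s2 H2] := hC.2 N; exists (s2 ++ s1).
  split; first exact: comp_series_cat hC.1 _ _ _ _ H1 H2 _ _ _ ip.
  by exists S'; split=> //; apply/List.in_or_app; right.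
have [s1 H1] := hC.2 L; exists (s2 ++ s1).
split; first exact: comp_series_cat hC.1 _ _ _ _ H1 H2 _ _ _ ip.
by exists S'; split=> //; apply/List.in_or_app; left.
Qed.

Lemma composition_factor_iso X Y S :
  isomorphic X Y -> composition_factor X S -> composition_factor Y S.
Proof. by move=> XY [s [Xs sS]]; exists s; split=> //; exact: comp_series_iso XY Xs. Qed.

Lemma composition_factor_simple X S : composition_factor X S -> simple S.
Proof.
move=> [s [Xs [S' [sS' S'S]]]]; apply: simple_iso S'S _.
exact: comp_series_simple Xs sS'.
Qed.

End CompositionFactors.

Section Wide.
Variables (C : preaddCat) (hC : length_category C).

Record wide (P : C -> Prop) : Prop := Wide {
  wide_zero : forall Z, is_zero Z -> P Z;
  wide_kernel : forall L X Y (k : hom L X) (f : hom X Y),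
    is_kernel k f -> P X -> P Y -> P L;
  wide_cokernel : forall X Y N (c : hom Y N) (f : hom X Y),
    is_cokernel c f -> P X -> P Y -> P N;
  wide_ext : forall L X N (i : hom L X) (p : hom X N),
    ses i p -> P L -> P N -> P X }.

Section OneWide.
Variables (P : C -> Prop) (hP : wide P).
Local Notation D := (full_subcat P).

Lemma full_zero (x : D) : @is_zero C (sval x) <-> is_zero x.
Proof. by rewrite !is_zeroP. Qed.

Lemma full_kernel (l x y : D) (k : hom l x) (f : hom x y) :
  @is_kernel C (sval l) (sval x) (sval y) k f -> is_kernel k f.
Proof. by case=> fk ku; split=> // z; exact: ku. Qed.

Lemma full_cokernel (x y n : D) (c : hom y n) (f : hom x y) :
  @is_cokernel C (sval x) (sval y) (sval n) c f -> is_cokernel c f.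
Proof. by case=> fk ku; split=> // z; exact: ku. Qed.

Lemma full_ses (l x n : D) (i : hom l x) (p : hom x n) :
  @ses C (sval l) (sval x) (sval n) i p -> ses i p.
Proof. by case=> *; split; [exact: full_kernel|exact: full_cokernel]. Qed.

Lemma full_iso (x y : D) :
  @isomorphic C (sval x) (sval y) <-> isomorphic x y.
Proof. by []. Qed.

(** The kernel of a map of the subcategory lies in the subcategory, so a map
    that is mono there has kernel zero. *)
Lemma wide_mono (x y : D) (f : hom x y) :
  mono f -> @mono C (sval x) (sval y) f.
Proof.
move=> fm; have [L [k kf]] := ab_kernel hC.1 (f : @hom C (sval x) (sval y)).
have PL : P L by exact: wide_kernel hP _ _ _ _ _ kf (svalP x) (svalP y).
have k0 : k = 0.
  apply: (fm (exist _ L PL) k 0).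
  by rewrite compm0; exact: kf.1.
apply/mono0P => Z g /(kernel_lift kf)[h <-].
by rewrite k0 comp0m.
Qed.

Lemma wide_epi (x y : D) (f : hom x y) :
  epi f -> @epi C (sval x) (sval y) f.
Proof.
move=> fm; have [N [c cf]] := ab_cokernel hC.1 (f : @hom C (sval x) (sval y)).
have PN : P N by exact: wide_cokernel hP _ _ _ _ _ cf (svalP x) (svalP y).
have c0 : c = 0.
  apply: (fm (exist _ N PN) c 0).
  by rewrite comp0m; exact: cf.1.
apply/epi0P => Z g /(cokernel_desc cf)[h <-].
by rewrite c0 compm0.
Qed.

Lemma wide_abelian : abelian D.
Proof.
split.
- have [Z Z0] := ab_zero hC.1; exists (exist _ Z (wide_zero hP Z0)).
  exact/full_zero.
- move=> [M1 P1] [M2 P2].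
  have [M [i1 [i2 [p1 [p2 b]]]]] := ab_biproduct hC.1 M1 M2.
  have PM := wide_ext hP (ses_biproduct b) P1 P2.
  by exists (exist _ M PM), i1, i2, p1, p2; case: b.
- move=> x y f; have [L [k kf]] := ab_kernel hC.1 (f : @hom C (sval x) (sval y)).
  have PL := wide_kernel hP kf (svalP x) (svalP y).
  by exists (exist _ L PL), k; exact: full_kernel.
- move=> x y f; have [N [c cf]] := ab_cokernel hC.1 (f : @hom C (sval x) (sval y)).
  have PN := wide_cokernel hP cf (svalP x) (svalP y).
  by exists (exist _ N PN), c; exact: full_cokernel.
- move=> x y f /wide_mono /(mono_ses hC.1)[N [c fc]].
  have PN := wide_cokernel hP fc.2 (svalP x) (svalP y).
  by exists (exist _ N PN), c; apply: full_kernel; exact: fc.1.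
- move=> x y f /wide_epi /(epi_ses hC.1)[L [k kf]].
  have PL := wide_kernel hP kf.1 (svalP x) (svalP y).
  by exists (exist _ L PL), k; apply: full_cokernel; exact: kf.2.
Qed.

Lemma wide_ses (l x n : D) (i : hom l x) (p : hom x n) :
  ses i p -> @ses C (sval l) (sval x) (sval n) i p.
Proof.
move=> ip; have pe := wide_epi (ses_epi ip).
have [L [k kp]] := epi_ses hC.1 pe.
have PL := wide_kernel hP kp.1 (svalP x) (svalP n).
have [|h ih] := ses_lift ip (g := k : @hom D (exist _ L PL) x).
  exact: ses_comp0 kp.
apply: (kernel_epi_ses hC.1) => //; apply: is_kernelI.
- exact: wide_mono (ses_mono ip).
- exact: ses_comp0 ip.
- move=> Z g /(ses_lift kp)[t <-]; exists (@comp C _ _ _ h t).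
  by rewrite compA; congr (@comp C _ _ _ _ _); exact: ih.
Qed.

(** A nonzero factor object in the subcategory of least length is simple in the
    subcategory. *)
Lemma wide_length_category : length_category D.
Proof.
split=> [|x]; first exact: wide_abelian.
have [n] := ubnP (len hC (sval x)); elim: n x => // n IH [X PX]; rewrite ltnS /= => Xn.
have [X0|X0] := pselect (is_zero X).
  by exists [::]; apply: comp_series_zero; exact/full_zero.
have [|N [[PN N0 [p pe]] Nmin]] := @exists_min_len _ hC (fun N =>
    [/\ P N, ~ is_zero N & exists p : hom X N, epi p]).
  by exists X; split=> //; exists (idm X); exact: idm_epi.
have [K [k kp]] := epi_ses hC.1 pe.
have PK := wide_kernel hP kp.1 PX PN.
have [|s Ks] := IH (exist _ K PK).
  apply: leq_trans Xn; apply: leq_trans (len_ses hC kp).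
  by rewrite -addn1 leq_add2l; exact: len_gt0.
exists (exist _ N PN :: s).
apply: (@comp_series_cons (full_subcat P) (exist _ K PK) (exist _ X PX)
  (exist _ N PN) k p) => //.
  by apply: full_ses; exact: kp.
split=> [/full_zero//|[L PL] i /wide_mono /= im].
(* The quotient of [N] by a nonzero subobject would be shorter than [N]. *)
have [Q [c ic]] := mono_ses hC.1 im.
have PQ := wide_cokernel hP ic.2 PL PN.
have [Q0|Q0] := pselect (is_zero Q); first by right; exact: ses_iso_sub ic Q0.
left; apply/full_zero/(@len0_zero _ hC)/eqP; rewrite -leqn0 -(leq_add2r (len hC Q)).
apply: leq_trans (len_ses hC ic) _; apply: Nmin; split=> //.
by exists (c \oc p); exact: epi_comp (ses_epi ic) pe.
Qed.

End OneWide.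

(** The support [supp theta] is the instance [P := Wcl theta]. *)
Definition wide_factor (P : C -> Prop) (X S : C) : Prop :=
  exists (hX : P X) (hS : P S),
    @composition_factor (full_subcat P) (exist _ X hX) (exist _ S hS).

Lemma wide_factor_ses P L X N (i : hom L X) (p : hom X N) S :
  wide P -> P L -> P N -> ses i p ->
  wide_factor P X S <-> wide_factor P L S \/ wide_factor P N S.
Proof.
move=> hP PL PN ip; have PX := wide_ext hP ip PL PN.
have ip' : @ses (full_subcat P) (exist _ L PL) (exist _ X PX) (exist _ N PN) i p.
  exact: full_ses.
have H hS := composition_factor_ses (wide_length_category hP) (exist _ S hS) ip'.
split=> [[hX [hS]]|[[hL [hS]]|[hN [hS]]]].
- rewrite (Prop_irrelevance hX PX) => /H[cf|cf].
    by left; exists PL, hS.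
  by right; exists PN, hS.
- by rewrite (Prop_irrelevance hL PL) => cf; exists PX, hS; apply/H; left.
- by rewrite (Prop_irrelevance hN PN) => cf; exists PX, hS; apply/H; right.
Qed.

Lemma wide_factor_iso (P : C -> Prop) X Y S :
  P Y -> isomorphic X Y -> wide_factor P X S -> wide_factor P Y S.
Proof.
move=> PY XY [hX [hS cf]]; exists PY, hS.
by apply: composition_factor_iso cf.
Qed.

Lemma comp_series_transfer P Q (x : full_subcat P) s :
  wide P -> wide Q -> comp_series x s ->
  (forall S, List.In S s ->
     exists hS : Q (sval S), @simple (full_subcat Q) (exist _ (sval S) hS)) ->
  exists (hx : Q (sval x)) (s' : seq (full_subcat Q)),
    comp_series (exist _ (sval x) hx : full_subcat Q) s' /\
    List.map sval s' = List.map sval s.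
Proof.
move=> hP hQ; elim=> {x s} [x x0 _|l x S i p s ip Ss _ IH H].
  have {}x0 : @is_zero C (sval x) by exact/full_zero.
  exists (wide_zero hQ x0), [::]; split=> //.
  by apply: comp_series_zero; exact/full_zero.
have [|Ql [s' [ls' es]]] := IH; first by move=> S' sS'; apply: H; right.
have [|QS Ss'] := H S; first by left.
have ip' := wide_ses hP ip.
exists (wide_ext hQ ip' Ql QS), (exist _ (sval S) QS :: s'); split; last first.
  by rewrite /= es.
apply: (@comp_series_cons (full_subcat Q) (exist _ (sval l) Ql)
  (exist _ (sval x) (wide_ext hQ ip' Ql QS)) (exist _ (sval S) QS) i p) => //.
by apply: full_ses; exact: ip'.
Qed.

(** A composition series of [X] in [P] whose factors are simple in [Q] is a
    composition series of [X] in [Q], because [Q] is closed under extensions. *)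
Lemma wide_factor_transfer P Q X S :
  wide P -> wide Q ->
  (forall S', wide_factor P X S' -> exists X', wide_factor Q X' S') ->
  wide_factor P X S -> wide_factor Q X S.
Proof.
move=> hP hQ PQ PXS; have [X' [_ [QS _]]] := PQ S PXS.
case: PXS => PX [PS [s [Xs [S' [sS' S'S]]]]].
have [|QX [s' [Xs' es]]] := comp_series_transfer hP hQ Xs.
  move=> S0 sS0; have [|X0 [QX0 [QS0 cf]]] := PQ (sval S0).
    exists PX, (svalP S0), s; split=> //; exists S0; split=> //.
    by apply/full_iso; exists (idm _); exact: iso_id.
  by exists QS0; exact: composition_factor_simple cf.
exists QX, QS, s'; split=> //.
have := List.in_map sval _ _ sS'; rewrite -es => /List.in_map_iff[S'' [e s'S'']].
exists S''; split=> //.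
suff : @isomorphic C (sval S'') S by [].
by rewrite e.
Qed.

End Wide.

(** ** The wide subcategory of semistable objects *)

Section Semistable.
Variables (R : realType) (C : preaddCat) (hC : length_category C).
Variable theta : {scalar K0R R C}.
Implicit Types X Y Z L M N S : C.

Lemma Wcl_ev0 X : Wcl theta X -> ev theta X = 0.
Proof.
case=> TX FX; apply/le_anti/andP; split; first exact: FX (@idm_mono _ X).
exact: TX (@idm_epi _ X).
Qed.

Lemma Fbar_Wcl X : ev theta X = 0 -> Fbar theta X -> Wcl theta X.
Proof.
move=> X0 FX; split=> // N p /(epi_ses hC.1)[L [i ip]].
have := FX _ _ (ses_mono ip).
by rewrite -(lerD2r (ev theta N)) -(ev_ses theta ip) X0 add0r.
Qed.

Lemma Tbar_Wcl X : ev theta X = 0 -> Tbar theta X -> Wcl theta X.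
Proof.
move=> X0 TX; split=> // L i /(mono_ses hC.1)[N [p ip]].
have := TX _ _ (ses_epi ip).
by rewrite -(lerD2l (ev theta L)) -(ev_ses theta ip) X0 addr0.
Qed.

(** The image of a map between semistable objects has weight zero, being both
    a factor object and a subobject of such; hence so do kernel and cokernel. *)
Lemma Wcl_image X Y I (m : hom I Y) (e : hom X I) :
  mono m -> epi e -> Wcl theta X -> Wcl theta Y -> ev theta I = 0.
Proof.
move=> mm ee [TX _] [_ FY]; apply/le_anti/andP.
by split; [exact: FY mm|exact: TX ee].
Qed.

Lemma Wcl_wide : wide (Wcl theta).
Proof.
have TFb := Tbar_Fcl_torsion_pair hC theta.
have TF := Tcl_Fbar_torsion_pair hC theta.
split.
- move=> Z Z0; apply: Fbar_Wcl => [|L i im]; first exact: ev_zero.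
  by rewrite ev_zero //; exact: mono_zero im Z0.
- move=> L X Y k f kf WX WY.
  have [I [m [e [mm ee fE]]]] := image_factor hC.1 f.
  have ke : ses k e.
    apply: (kernel_epi_ses hC.1) => //; apply: is_kernelI.
    + exact: kernel_mono kf.
    + by apply: mm; rewrite compm0 compA -fE; exact: kf.1.
    + by move=> Z g eg; apply: (kernel_lift kf); rewrite fE -compA eg compm0.
  apply: Fbar_Wcl; last exact: tfree_sub TF _ _ _ (ses_mono ke) WX.2.
  by have := ev_ses theta ke; rewrite (Wcl_ev0 WX) (Wcl_image mm ee WX WY) addr0.
- move=> X Y N c f cf WX WY.
  have [I [m [e [mm ee fE]]]] := image_factor hC.1 f.
  have mc : ses m c.
    apply: (mono_cokernel_ses hC.1) => //; apply: is_cokernelI.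
    + exact: cokernel_epi cf.
    + by apply: ee; rewrite comp0m -compA -fE; exact: cf.1.
    + by move=> Z g gm; apply: (cokernel_desc cf); rewrite fE compA gm comp0m.
  apply: Tbar_Wcl; last exact: tors_quot TFb _ _ _ (ses_epi mc) WY.1.
  by have := ev_ses theta mc; rewrite (Wcl_ev0 WY) (Wcl_image mm ee WX WY) add0r.
- move=> L X N i p ip [TL FL] [TN FN].
  split; first exact: tors_ext TFb _ _ _ _ _ ip TL TN.
  exact: tfree_ext TF _ _ _ _ _ ip FL FN.
Qed.

End Semistable.

(** * Equivalence of torsion parts *)

Section Subobjects.
Variables (C : preaddCat) (hC : abelian C).
Implicit Types X Y Z L M N : C.

Lemma quotient_ses M (U : subobj M) : ses (sub_map U) (quot_map (quotient U)).
Proof.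
apply: (mono_cokernel_ses hC); first exact: sub_mono.
apply: (@pick_orP _ _ (fun Q => is_cokernel (quot_map Q) (sub_map U))).
have [N [c cU]] := ab_cokernel hC (sub_map U).
by exists (Quotobj (cokernel_epi cU)).
Qed.

Lemma sub_le_antisym M (U V : subobj M) : sub_le U V -> sub_le V U -> sub_eq U V.
Proof.
move=> [h Vh] [k Uk]; exists h; split=> //; exists k.
split; first by apply: (@sub_mono _ _ U); rewrite compA Uk Vh compm1.
by apply: (@sub_mono _ _ V); rewrite compA Vh Uk compm1.
Qed.

Lemma sub_eq_le M (U V : subobj M) : sub_eq U V -> sub_le U V /\ sub_le V U.
Proof.
case=> f [[g [gf fg]] Vf]; split; first by exists f.
by exists g; rewrite -Vf -compA fg compm1.
Qed.

Lemma quot_eq_sub_eq M (U V : subobj M) :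
  quot_eq (quotient U) (quotient V) <-> sub_eq U V.
Proof.
split=> [[f [[g [gf fg]] fq]]|/sub_eq_le[UV VU]].
  apply: sub_le_antisym.
    apply: (ses_lift (quotient_ses V)).
    by rewrite -fq -compA (ses_comp0 (quotient_ses U)) compm0.
  apply: (ses_lift (quotient_ses U)).
  rewrite -(comp1m (quot_map _)) -gf -(compA g) fq -compA.
  by rewrite (ses_comp0 (quotient_ses V)) compm0.
have [||f [fi fq]] := ses_iso_desc (quotient_ses U) (quotient_ses V)
  (comp1m (idm M)) (comp1m (idm M)).
- by rewrite comp1m.
- by rewrite comp1m.
by exists f; rewrite fq compm1.
Qed.

Lemma sub_in_iso M (U V : subobj M) : sub_le U V ->
  exists f : hom (sub_dom (sub_in U V)) (sub_dom U),
    iso f /\ sub_map U \oc f = sub_map V \oc sub_map (sub_in U V).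
Proof.
case=> h Vh; apply: (@pick_orP _ _ (fun W : subobj (sub_dom V) =>
  exists f : hom (sub_dom W) (sub_dom U),
    iso f /\ sub_map U \oc f = sub_map V \oc sub_map W)).
have hm : mono h by apply: (mono_compr (g := sub_map V)); rewrite Vh; exact: sub_mono.
by exists (Subobj hm), (idm _); split; [exact: iso_id|rewrite compm1].
Qed.

Lemma largest_subP (T F : C -> Prop) M :
  torsion_pair T F -> is_largest_sub T (largest_sub T M).
Proof. by move=> TF; apply: pick_orP; exact: largest_tors_exists TF M. Qed.

Lemma largest_sub_seq (T F : C -> Prop) M : torsion_pair T F ->
  tors_seq T F (sub_map (largest_sub T M)) (quot_map (quotient (largest_sub T M))).
Proof.
move=> TF; apply: (largest_tors_seq hC TF); last exact: quotient_ses.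
exact: largest_subP TF.
Qed.

(** The torsion parts of [M] for [T] and [T'] coincide as soon as each of them
    lies in the other class, since both are largest; in this form the condition
    no longer mentions the embeddings into [M]. *)
Definition same_tors (T T' : C -> Prop) M : Prop :=
  T' (sub_dom (largest_sub T M)) /\ T (sub_dom (largest_sub T' M)).

Section TwoPairs.
Variables (T F T' F' : C -> Prop).
Hypotheses (TF : torsion_pair T F) (TF' : torsion_pair T' F').

Lemma same_torsP M :
  same_tors T T' M <-> sub_eq (largest_sub T M) (largest_sub T' M).
Proof.
have [TU Umax] := largest_subP M TF; have [TV Vmax] := largest_subP M TF'.
split=> [[T'U TV']|[f [fi _]]].
  by apply: sub_le_antisym; [exact: Vmax|exact: Umax].
split; first by apply: (tors_iso TF') TV; apply: isomorphic_sym; exists f.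
by apply: (tors_iso TF) TU; exists f.
Qed.

Lemma same_tors_biproduct M1 M2 M (i1 : hom M1 M) (i2 : hom M2 M)
    (p1 : hom M M1) (p2 : hom M M2) :
  is_biproduct i1 i2 p1 p2 ->
  same_tors T T' M <-> same_tors T T' M1 /\ same_tors T T' M2.
Proof.
move=> b.
have [[a1 [a2 [b1 [b2 bU]]]] _] := tors_seq_biproduct TF b
  (largest_sub_seq M TF) (largest_sub_seq M1 TF) (largest_sub_seq M2 TF).
have [[a1' [a2' [b1' [b2' bU']]]] _] := tors_seq_biproduct TF' b
  (largest_sub_seq M TF') (largest_sub_seq M1 TF') (largest_sub_seq M2 TF').
have := tors_biproduct TF' bU; have := tors_biproduct TF bU'.
by rewrite /same_tors; tauto.
Qed.

(** If [T] is not contained in [T'], some brick lies in [T] and in [F']; it is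
    its own torsion part for [T] while its torsion part for [T'] vanishes. *)
Lemma same_tors_bricks :
  (forall B, brick B -> same_tors T T' B) ->
  (forall X : C, finite_length X) -> forall X, T X -> T' X.
Proof.
move=> same fl; apply: (torsion_le_bricks (conj hC fl) TF TF') => B bB TB F'B.
have [T'U _] := same B bB.
have [h hU] := largest_lift hC TF (idm B) (largest_subP B TF) TB.
apply: bB.1; apply: (tors_tfree0 TF') F'B.
exact: (tors_quot TF' (retract_epi hU)) T'U.
Qed.

Lemma torsion_pair_tfree_eq :
  (forall X, T X <-> T' X) -> forall Y, F Y <-> F' Y.
Proof.
move=> TT' Y; rewrite (tfreeP TF) (tfreeP TF').
by split=> H X /TT'; exact: H.
Qed.

End TwoPairs.
End Subobjects.

Section SemistablePart.
Variables (R : realType) (C : preaddCat) (hC : length_category C).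
Implicit Types (theta eta : {scalar K0R R C}) (M X : C).

Lemma t_sub_le_tbar theta M : sub_le (t_sub theta M) (tbar_sub theta M).
Proof.
have [TU _] := largest_subP M (Tcl_Fbar_torsion_pair hC theta).
have [_ Vmax] := largest_subP M (Tbar_Fcl_torsion_pair hC theta).
exact/Vmax/Tcl_Tbar.
Qed.

(** The part [w M] is the torsion-free quotient of [tbar M] for the pair
    [(Tcl, Fbar)]: the largest [Tcl]-subobject of [tbar M] is that of [M]. *)
Lemma w_seq theta M :
  tors_seq (Tcl theta) (Fbar theta)
    (sub_map (sub_in (t_sub theta M) (tbar_sub theta M)))
    (quot_map (sq_quot (w_subquot theta M))).
Proof.
have TF := Tcl_Fbar_torsion_pair hC theta.
apply: (largest_tors_seq hC.1 TF); last exact: quotient_ses hC.1 _ _.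
have [f [fi Uf]] := sub_in_iso (t_sub_le_tbar theta M).
have Ul := largest_subP M TF; split.
  by apply: (tors_iso TF) Ul.1; apply: isomorphic_sym; exists f.
move=> V TV; case: fi => g [gf fg].
have [h hV] := largest_lift hC.1 TF (sub_map (tbar_sub theta M) \oc sub_map V) Ul TV.
exists (g \oc h); apply: (@sub_mono _ _ (tbar_sub theta M)).
by rewrite compA -Uf -compA (compA f) fg comp1m.
Qed.

Lemma w_obj_Wcl theta M : Wcl theta (w_obj theta M).
Proof.
have [s _ Fw] := w_seq theta M; split=> //.
have TFb := Tbar_Fcl_torsion_pair hC theta.
exact: tors_quot TFb _ _ _ (ses_epi s) (largest_subP M TFb).1.
Qed.

Lemma w_subquot_eq theta eta M :
  same_tors (Tcl theta) (Tcl eta) M -> same_tors (Tbar theta) (Tbar eta) M ->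
  subquot_eq (w_subquot theta M) (w_subquot eta M).
Proof.
move=> [st st'] /(same_torsP (Tbar_Fcl_torsion_pair hC theta)
  (Tbar_Fcl_torsion_pair hC eta)) [f [fi ef]].
have TF := Tcl_Fbar_torsion_pair hC theta; have TF' := Tcl_Fbar_torsion_pair hC eta.
have [a [ai _]] := sub_in_iso (t_sub_le_tbar theta M).
have [a' [ai' _]] := sub_in_iso (t_sub_le_tbar eta M).
have ws := w_seq theta M; have ws' := w_seq eta M.
case: (ws) (ws') => [wse _ _] [wse' _ _].
case: (fi) => g [gf fg].
have [||h [hi hq]] := ses_iso_desc wse wse' gf fg.
- apply: (tors_seq_lift TF' ws').
  by apply: (tors_iso TF') st; apply: isomorphic_sym; exists a.
- apply: (tors_seq_lift TF ws).
  by apply: (tors_iso TF) st'; apply: isomorphic_sym; exists a'.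
by exists f, h.
Qed.

Lemma MTF_equivP theta eta M :
  MTF_equiv M theta eta <->
  [/\ same_tors (Tcl theta) (Tcl eta) M, same_tors (Tbar theta) (Tbar eta) M
    & forall S, supp theta (w_obj theta M) S <-> supp eta (w_obj eta M) S].
Proof.
have TF := Tcl_Fbar_torsion_pair hC theta; have TF' := Tcl_Fbar_torsion_pair hC eta.
have TFb := Tbar_Fcl_torsion_pair hC theta.
have TFb' := Tbar_Fcl_torsion_pair hC eta.
split=> [[et _ ef es]|[st sb es]].
  split=> //; first exact/(same_torsP TF TF').
  by apply/(same_torsP TFb TFb')/(quot_eq_sub_eq hC.1).
split=> //; first exact/(same_torsP TF TF').
  exact: w_subquot_eq.
by apply/(quot_eq_sub_eq hC.1)/(same_torsP TFb TFb').
Qed.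

Lemma supp_w_biproduct theta M1 M2 M (i1 : hom M1 M) (i2 : hom M2 M)
    (p1 : hom M M1) (p2 : hom M M2) S :
  is_biproduct i1 i2 p1 p2 ->
  supp theta (w_obj theta M) S <->
  supp theta (w_obj theta M1) S \/ supp theta (w_obj theta M2) S.
Proof.
move=> b.
have TF := Tcl_Fbar_torsion_pair hC theta.
have TFb := Tbar_Fcl_torsion_pair hC theta.
have [[a1 [a2 [b1 [b2 bU]]]] _] := tors_seq_biproduct TFb b
  (largest_sub_seq hC.1 M TFb) (largest_sub_seq hC.1 M1 TFb)
  (largest_sub_seq hC.1 M2 TFb).
have [_ [c1 [c2 [d1 [d2 bW]]]]] :=
  tors_seq_biproduct TF bU (w_seq theta M) (w_seq theta M1) (w_seq theta M2).
exact: (wide_factor_ses hC S (Wcl_wide hC theta) (w_obj_Wcl theta M1)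
  (w_obj_Wcl theta M2) (ses_biproduct bW)).
Qed.

(** One inclusion between the supports of a summand [N] of [M]: composition
    factors of [w N] for [theta] are among those of [w M] for [eta], hence
    simple for [eta]. *)
Lemma supp_w_transfer theta eta M N S :
  same_tors (Tcl theta) (Tcl eta) N -> same_tors (Tbar theta) (Tbar eta) N ->
  (forall S', supp theta (w_obj theta N) S' -> supp eta (w_obj eta M) S') ->
  supp theta (w_obj theta N) S -> supp eta (w_obj eta N) S.
Proof.
move=> st sb sub sS; have [f [g [_ gi _ _]]] := w_subquot_eq st sb.
apply: (@wide_factor_iso _ _ (w_obj theta N)); first exact: w_obj_Wcl.
  by exists g.
apply: (wide_factor_transfer hC (Wcl_wide hC theta) (Wcl_wide hC eta)) sS.
by move=> S' /sub; exists (w_obj eta M).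
Qed.

Lemma same_tors_sym (T T' : C -> Prop) M : same_tors T T' M -> same_tors T' T M.
Proof. by case. Qed.

Lemma MTF_equiv_biproduct theta eta M1 M2 M (i1 : hom M1 M) (i2 : hom M2 M)
    (p1 : hom M M1) (p2 : hom M M2) :
  is_biproduct i1 i2 p1 p2 ->
  MTF_equiv M theta eta <-> MTF_equiv M1 theta eta /\ MTF_equiv M2 theta eta.
Proof.
move=> b; rewrite !MTF_equivP.
have bt := same_tors_biproduct hC.1 (Tcl_Fbar_torsion_pair hC theta)
  (Tcl_Fbar_torsion_pair hC eta) b.
have bb := same_tors_biproduct hC.1 (Tbar_Fcl_torsion_pair hC theta)
  (Tbar_Fcl_torsion_pair hC eta) b.
have bs S := supp_w_biproduct theta S b; have bs' S := supp_w_biproduct eta S b.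
split=> [[/bt[t1 t2] /bb[c1 c2] s]|[[t1 c1 s1] [t2 c2 s2]]]; last first.
  split; [exact/bt|exact/bb|move=> S].
  by have := bs S; have := bs' S; have := s1 S; have := s2 S; tauto.
split; split=> // S; split.
- by apply: (supp_w_transfer (M := M)) => // S' sS'; apply/s/bs; left.
- apply: (supp_w_transfer (M := M)); try exact: same_tors_sym.
  by move=> S' sS'; apply/s/bs'; left.
- by apply: (supp_w_transfer (M := M)) => // S' sS'; apply/s/bs; right.
- apply: (supp_w_transfer (M := M)); try exact: same_tors_sym.
  by move=> S' sS'; apply/s/bs'; right.
Qed.

Lemma TF_equiv_MTF theta eta M : TF_equiv theta eta -> MTF_equiv M theta eta.
Proof.
case=> eb _ et ef; apply/MTF_equivP.
have Eb : Tbar theta = Tbar eta by apply/funext => X; apply/propext.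
have Et : Tcl theta = Tcl eta by apply/funext => X; apply/propext.
have Ew : Wcl theta = Wcl eta.
  by apply/funext => X; rewrite /Wcl Eb; congr (_ /\ _); apply/propext.
have TF := Tcl_Fbar_torsion_pair hC eta; have TFb := Tbar_Fcl_torsion_pair hC eta.
rewrite /same_tors Eb Et; split.
- by have [] := largest_subP M TF.
- by have [] := largest_subP M TFb.
by move=> S; rewrite /w_obj /w_subquot /t_sub /tbar_sub /supp Eb Et Ew.
Qed.

Lemma MTF_bricks_TF_equiv theta eta :
  (forall B, brick B -> MTF_equiv B theta eta) -> TF_equiv theta eta.
Proof.
move=> H.
have TF := Tcl_Fbar_torsion_pair hC theta; have TF' := Tcl_Fbar_torsion_pair hC eta.
have TFb := Tbar_Fcl_torsion_pair hC theta.
have TFb' := Tbar_Fcl_torsion_pair hC eta.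
have et B : brick B -> same_tors (Tcl theta) (Tcl eta) B.
  by move=> /H /MTF_equivP[].
have eb B : brick B -> same_tors (Tbar theta) (Tbar eta) B.
  by move=> /H /MTF_equivP[].
have et_le := same_tors_bricks hC.1 TF TF' et hC.2.
have et_ge := same_tors_bricks hC.1 TF' TF (fun B bB => same_tors_sym (et B bB)) hC.2.
have eb_le := same_tors_bricks hC.1 TFb TFb' eb hC.2.
have eb_ge := same_tors_bricks hC.1 TFb' TFb (fun B bB => same_tors_sym (eb B bB)) hC.2.
have Et X : Tcl theta X <-> Tcl eta X by split; [exact: et_le|exact: et_ge].
have Eb X : Tbar theta X <-> Tbar eta X by split; [exact: eb_le|exact: eb_ge].
split=> //; first exact: torsion_pair_tfree_eq TFb TFb' Eb.
exact: torsion_pair_tfree_eq TF TF' Et.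
Qed.

End SemistablePart.

Theorem proposition3p2 (R : realType) (A : preaddCat)
    (hA : length_category A)
    (n : nat) (S : 'I_n -> A) (hS : lists_simples S)
    (theta eta : {scalar K0R R A}) :
  (forall (M1 M2 M : A) (i1 : hom M1 M) (i2 : hom M2 M)
          (p1 : hom M M1) (p2 : hom M M2),
     is_biproduct i1 i2 p1 p2 ->
     (MTF_equiv M theta eta <->
      MTF_equiv M1 theta eta /\ MTF_equiv M2 theta eta))
  /\
  ((TF_equiv theta eta <-> forall M : A, MTF_equiv M theta eta) /\
   ((forall M : A, MTF_equiv M theta eta) <->
    (forall M : A, brick M -> MTF_equiv M theta eta))).
Proof.
have TF_all : TF_equiv theta eta -> forall M, MTF_equiv M theta eta.
  by move=> H M; exact: TF_equiv_MTF.
have bricks_TF := MTF_bricks_TF_equiv hA (theta := theta) (eta := eta).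
split; first by move=> M1 M2 M i1 i2 p1 p2 b; exact: (MTF_equiv_biproduct hA theta eta b).
split; split=> //; first by move=> H; apply: bricks_TF => B _; exact: H.
by move/bricks_TF/TF_all.
Qed.
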